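(* Let $M$ be an $EMV$-algebra without top element which is a maximal ideal of the $MV$-algebra $N=\{x\in N\mid \text{either } x\in M \text{ or } \lambda_1(x)\in M\}$. Then $\mathcal{SM}(N)$ and $\mathrm{MaxI}(N)$ are the one-point compactifications of the spaces $\mathcal{SM}(M)$ and $\mathrm{MaxI}(M)$, respectively.
   Context: An $EMV$-algebra is an algebra $(M;\vee,\wedge,\oplus,0)$ of type $(2,2,2,0)$ such that: (i) $(M;\oplus,0)$ is a commutative monoid with neutral element $0$; (ii) $(M;\vee,\wedge,0)$ is a distributive lattice with bottom element $0$; (iii) for each idempotent $a$ of $M$ (an element with $a\oplus a=a$; $\mathcal I(M)$ denotes the set of idempotents), $([0,a];\oplus,\lambda_a,0,a)$ is an $MV$-algebra, where $[0,a]=\{x\in M\mid x\le a\}$ and $\lambda_a(x)=\min\{z\in[0,a]\mid z\oplus x=a\}$; (iv) for each $x\in M$ there is $a\in\mathcal I(M)$ with $x\le a$. Every $MV$-algebra is an $EMV$-algebra. Here $M$ is an $EMV$-subalgebra of the $MV$-algebra $N$ (a subset closed under $\vee,\wedge,\oplus,0$ and under $\lambda_b$ on $[0,b]\cap M$ for each idempotent $b\in M$), $1$ is the top element of $N$, $\lambda_1(x)=x^*$ is the $MV$-complement in $N$, and every element of $N$ is either in $M$ or is such that its complement is in $M$. An $EMV$-homomorphism is a map $f$ between $EMV$-algebras preserving $\vee,\wedge,\oplus,0$ with $f(\lambda_b(x))=\lambda_{f(b)}(f(x))$ for each idempotent $b$ and $x\in[0,b]$. A state-morphism on an $EMV$-algebra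 $M$ is an $EMV$-homomorphism $s:M\to[0,1]$ (with $[0,1]$ the standard $MV$-algebra, $x\oplus y=\min\{x+y,1\}$) such that $s(x)=1$ for some $x\in M$. $\mathcal{SM}(M)$ is the set of state-morphisms on $M$, equipped with the weak topology, i.e. the subspace topology inherited from the product topology on $[0,1]^M$ (likewise for $N$). An ideal is a non-empty subset $I$ that is downward closed and closed under $\oplus$; it is maximal if it is proper and not properly contained in another proper ideal. $\mathrm{MaxI}(M)$ is the set of maximal ideals of $M$ with the hull-kernel topology, whose open sets are $O(I)=\{A\in\mathrm{MaxI}(M)\mid A\not\supseteq I\}$, $I$ an ideal of $M$ (likewise for $N$). *)

(* Defs.v *)
From HB Require Import structures.
From mathcomp Require Import all_boot all_order all_algebra.
From mathcomp Require Import all_classical all_reals all_analysis.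
From mathcomp Require Import lra.
Import Order.TTheory GRing.Theory Num.Theory.
Import numFieldNormedType.Exports.

Set Implicit Arguments.
Unset Strict Implicit.
Unset Printing Implicit Defensive.

Local Open Scope classical_set_scope.
Local Open Scope ring_scope.

(* [(A; op, neg, zero, one)] is an MV-algebra, for a subset [A] of a type.
   The relative form is needed for the intervals [0,a] of an EMV-algebra. *)
Record is_mv_algebra (T : Type) (A : set T) (op : T -> T -> T) (neg : T -> T)
    (zero one : T) : Prop := IsMVAlgebra {
  mv_closed0 : A zero;
  mv_closedD : forall x y, A x -> A y -> A (op x y);
  mv_closedN : forall x, A x -> A (neg x);
  mv_addA : forall x y z, A x -> A y -> A z -> op x (op y z) = op (op x y) z;
  mv_addC : forall x y, A x -> A y -> op x y = op y x;
  mv_add0 : forall x, A x -> op x zero = x;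
  mv_negK : forall x, A x -> neg (neg x) = x;
  mv_neg0 : neg zero = one;
  mv_add1 : forall x, A x -> op x one = one;
  mv_luk : forall x y, A x -> A y ->
    op (neg (op (neg x) y)) y = op (neg (op (neg y) x)) x }.

Record mvAlgebra := MVAlgebra {
  mv_sort : Type;
  mv_oplus : mv_sort -> mv_sort -> mv_sort;
  mv_neg : mv_sort -> mv_sort;
  mv_zero : mv_sort;
  mv_one : mv_sort;
  mv_axioms : is_mv_algebra [set: mv_sort] mv_oplus mv_neg mv_zero mv_one }.

(* Algebras of the type (2,2,2,0) of EMV-algebras; the axioms are the separate
   predicate [is_emv_algebra]. *)
Record emvSig := EMVSig {
  emv_sort :> Type;
  emv_join : emv_sort -> emv_sort -> emv_sort;
  emv_meet : emv_sort -> emv_sort -> emv_sort;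
  emv_oplus : emv_sort -> emv_sort -> emv_sort;
  emv_zero : emv_sort }.

Arguments emv_join {e}.
Arguments emv_meet {e}.
Arguments emv_oplus {e}.
Arguments emv_zero {e}.

Section emv_theory.
Context {E : emvSig}.
Implicit Types (a b x y z : E) (A I : set E).

Definition emv_le x y : Prop := emv_meet x y = x.

Definition emv_idem a : Prop := emv_oplus a a = a.

(* [z] is lambda_a(x), the least element of {z in [0,a] | z (+) x = a}. The
   operation is kept as a relation, the minimum being unique when it exists. *)
Definition is_lambda a x z : Prop :=
  [/\ emv_le z a, emv_oplus z x = a
    & forall w, emv_le w a -> emv_oplus w x = a -> emv_le z w].

Record is_ideal I : Prop := IsIdeal {
  ideal_neq0 : I !=set0;
  ideal_down : forall x y, emv_le x y -> I y -> I x;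
  ideal_oplus : forall x y, I x -> I y -> I (emv_oplus x y) }.

Definition proper_ideal I : Prop := is_ideal I /\ I != setT.

Definition maximal_ideal A : Prop :=
  proper_ideal A /\ (forall I, proper_ideal I -> A `<=` I -> I = A).

Record is_emv_subalgebra A : Prop := IsEMVSubalgebra {
  emv_sub_join : forall x y, A x -> A y -> A (emv_join x y);
  emv_sub_meet : forall x y, A x -> A y -> A (emv_meet x y);
  emv_sub_oplus : forall x y, A x -> A y -> A (emv_oplus x y);
  emv_sub_zero : A emv_zero;
  emv_sub_lambda : forall b x z, A b -> emv_idem b -> A x -> emv_le x b ->
    is_lambda b x z -> A z }.

End emv_theory.

Definition has_top (E : emvSig) : Prop :=
  exists t : E, forall x : E, emv_le x t.

Record is_emv_algebra (E : emvSig) : Prop := IsEMVAlgebra {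
  emv_oplusA : associative (@emv_oplus E);
  emv_oplusC : commutative (@emv_oplus E);
  emv_oplus0 : right_id (@emv_zero E) emv_oplus;
  emv_joinA : associative (@emv_join E);
  emv_joinC : commutative (@emv_join E);
  emv_meetA : associative (@emv_meet E);
  emv_meetC : commutative (@emv_meet E);
  emv_joinKI : forall x y : E, emv_meet x (emv_join x y) = x;
  emv_meetKU : forall x y : E, emv_join x (emv_meet x y) = x;
  emv_meetUr : right_distributive (@emv_meet E) emv_join;
  emv_le0 : forall x : E, emv_le emv_zero x;
  emv_mv : forall a : E, emv_idem a -> exists lam : E -> E,
    (forall x, emv_le x a -> is_lambda a x (lam x)) /\
    is_mv_algebra [set x | emv_le x a] emv_oplus lam emv_zero a;
  emv_bounded : forall x : E, exists a, emv_idem a /\ emv_le x a }.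

(* [is_lambda] determines [z], so the last field says
   f (lambda_b x) = lambda_(f b) (f x). *)
Record is_emv_hom (E F : emvSig) (f : E -> F) : Prop := IsEMVHom {
  emv_hom_join : {morph f : x y / emv_join x y};
  emv_hom_meet : {morph f : x y / emv_meet x y};
  emv_hom_oplus : {morph f : x y / emv_oplus x y};
  emv_hom_zero : f emv_zero = emv_zero;
  emv_hom_lambda : forall b x z, emv_idem b -> emv_le x b ->
    is_lambda b x z -> is_lambda (f b) (f x) (f z) }.

(* The lattice operations of the natural order of an MV-algebra make it an
   algebra of the type of EMV-algebras. *)
Section mv_emv.
Variable N : mvAlgebra.

Definition mv_join (x y : mv_sort N) : mv_sort N :=
  mv_oplus (mv_neg (mv_oplus (mv_neg x) y)) y.

Definition mv_meet (x y : mv_sort N) : mv_sort N :=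
  mv_neg (mv_join (mv_neg x) (mv_neg y)).

Definition mv_emv : emvSig := EMVSig mv_join mv_meet (@mv_oplus N) (mv_zero N).

End mv_emv.

Coercion mv_emv : mvAlgebra >-> emvSig.

Section sub_emv.
Variables (E : emvSig) (A : set E) (subA : is_emv_subalgebra A).
Implicit Types x y : A.

Definition sub_join x y : A :=
  SigSub (mem_set (emv_sub_join subA (set_valP x) (set_valP y))).
Definition sub_meet x y : A :=
  SigSub (mem_set (emv_sub_meet subA (set_valP x) (set_valP y))).
Definition sub_oplus x y : A :=
  SigSub (mem_set (emv_sub_oplus subA (set_valP x) (set_valP y))).
Definition sub_zero : A := SigSub (mem_set (emv_sub_zero subA)).

Definition sub_emv : emvSig := EMVSig sub_join sub_meet sub_oplus sub_zero.

End sub_emv.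

Section unit_interval.
Variable R : realType.

Definition unit_itv : Type := [set x : R | 0 <= x <= 1].

HB.instance Definition _ := Topological.on unit_itv.

Definition unit_oplus (x y : unit_itv) : unit_itv.
Proof.
exists (Num.min (val x + val y) 1); apply: mem_set.
have /andP[x0 _] := set_valP x; have /andP[y0 _] := set_valP y.
by rewrite /= le_min addr_ge0 // ler01 ge_min lexx orbT.
Defined.

Definition unit_neg (x : unit_itv) : unit_itv.
Proof.
exists (1 - val x); apply: mem_set.
by have /andP[x0 x1] := set_valP x; rewrite /= subr_ge0 x1 gerBl.
Defined.

Definition unit_zero : unit_itv.
Proof. by exists 0; apply: mem_set; rewrite /= lexx ler01. Defined.

Definition unit_one : unit_itv.
Proof. by exists 1; apply: mem_set; rewrite /= lexx ler01. Defined.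

Lemma unit_mv_axioms : is_mv_algebra [set: unit_itv]
  unit_oplus unit_neg unit_zero unit_one.
Proof.
have bnd (x : unit_itv) : 0 <= sval x <= 1 by exact: set_valP x.
split=> //= => [x y z _ _ _|x y _ _|x _|x _||x _|x y _ _];
  apply: val_inj => /=; rewrite ?subr0 //.
- have /andP[x0 x1] := bnd x; have /andP[y0 y1] := bnd y.
  have /andP[z0 z1] := bnd z.
  by case: (leP (sval y + sval z) 1) => ?; case: (leP (sval x + sval y) 1) => ?;
    do !case: leP => ?; lra.
- by rewrite addrC.
- by have /andP[x0 x1] := bnd x; case: leP => ?; lra.
- by rewrite subKr.
- by have /andP[x0 x1] := bnd x; case: leP => ?; lra.
- have /andP[x0 x1] := bnd x; have /andP[y0 y1] := bnd y.
  by case: (leP (1 - sval x + sval y) 1) => ?;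
    case: (leP (1 - sval y + sval x) 1) => ?; do !case: leP => ?; lra.
Qed.

Definition unit_mv : mvAlgebra := MVAlgebra unit_mv_axioms.

End unit_interval.

Definition state_morphism (R : realType) (E : emvSig) (s : E -> unit_mv R) :
  Prop := is_emv_hom s /\ exists x, s x = unit_one R.

(* A subset of the product space [0,1]^E, with the subspace topology. *)
Definition SM (R : realType) (E : emvSig) : Type :=
  [set s : prod_topology (fun _ : E => unit_itv R) | @state_morphism R E s].

HB.instance Definition _ R E := Topological.on (SM R E).

Definition MaxI (E : emvSig) : Type := {A : set E | maximal_ideal A}.

HB.instance Definition _ E := gen_eqMixin (MaxI E).
HB.instance Definition _ E := gen_choiceMixin (MaxI E).

(* O(I) *)
Definition hull_kernel (E : emvSig) (I : set E) : set (MaxI E) :=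
  [set A | ~ (I `<=` proj1_sig A)].

HB.instance Definition _ E := isSubBaseTopological.Build (MaxI E)
  [set I : set E | is_ideal I] (@hull_kernel E).

(* The sets O(I) are only taken as a subbase above. For an MV-algebra and for an
   EMV-subalgebra of an MV-algebra, the generated topology has no other open
   sets: see [open_MaxI_mv] and [open_MaxI_sub]. *)
Record subdistributive (E : emvSig) : Prop := Subdistributive {
  sd_refl : forall x : E, emv_le x x;
  sd_trans : forall y x z : E, emv_le x y -> emv_le y z -> emv_le x z;
  sd_le0 : forall x : E, emv_le emv_zero x;
  sd_meetl : forall x y : E, emv_le (emv_meet x y) x;
  sd_meetr : forall x y : E, emv_le (emv_meet x y) y;
  sd_meet : forall x y z : E, emv_le z x -> emv_le z y ->
    emv_le z (emv_meet x y);
  sd_meet_add : forall x y z : E, emv_le (emv_meet x (emv_oplus y z))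
    (emv_oplus (emv_meet x y) (emv_meet x z)) }.

Section open_MaxI.
Variables (E : emvSig) (sdE : subdistributive E).
Implicit Types (x y z : E) (A I J : set E).

Lemma maximal_ideal_prime A x y : maximal_ideal A -> A (emv_meet x y) ->
  A x \/ A y.
Proof.
move=> [[idA _] maxA] Axy; have [?|nAx] := pselect (A x); first by left.
right; pose J := [set z | A (emv_meet y z)].
have Jx : J x.
  by apply: (ideal_down idA) Axy; apply: (sd_meet sdE);
    [exact: (sd_meetr sdE) | exact: (sd_meetl sdE)].
have idJ : is_ideal J.
  split; first by exists x.
  - move=> u v uv; apply: (ideal_down idA); apply: (sd_meet sdE).
      exact: (sd_meetl sdE).
    by apply: (sd_trans sdE) uv; exact: (sd_meetr sdE).
  - move=> u v Ju Jv; apply: (ideal_down idA (sd_meet_add sdE _ _ _)).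
    exact: (ideal_oplus idA).
have AJ : A `<=` J by move=> z; apply: (ideal_down idA); exact: (sd_meetr sdE).
have JT : J = setT.
  by apply: contrapT => /eqP nJT; apply: nAx; rewrite -(maxA J).
have : J y by rewrite JT.
by apply: (ideal_down idA); apply: (sd_meet sdE); exact: (sd_refl sdE).
Qed.

Let ideal0 I : is_ideal I -> I emv_zero.
Proof.
by move=> idI; have [x] := ideal_neq0 idI; apply: (ideal_down idI (sd_le0 sdE x)).
Qed.

Let hull_kernelT : @hull_kernel E setT = setT.
Proof.
apply/seteqP; split=> // -[A mA] _ TA.
by have [[_ /eqP AT] _] := mA; apply: AT; apply/seteqP.
Qed.

Let hull_kernelI I J : is_ideal I -> is_ideal J ->
  @hull_kernel E I `&` hull_kernel J = hull_kernel (I `&` J).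
Proof.
move=> idI idJ; apply/seteqP; split=> [[A mA] /= [nI nJ] IJ|[A mA] /= nIJ].
  apply: nI => x Ix; apply: contrapT => nAx; apply: nJ => y Jy.
  have [||//] := @maximal_ideal_prime A x y mA; last by move=> /nAx.
  apply: IJ; split; first exact: (ideal_down idI (sd_meetl sdE x y)).
  exact: (ideal_down idJ (sd_meetr sdE x y)).
by split=> IA; apply: nIJ => x [Ix Jx]; apply: IA.
Qed.

Let ideal_bigcap (F : set (set E)) : F `<=` is_ideal ->
  is_ideal (\bigcap_(I in F) I).
Proof.
move=> Fid; split.
- by exists emv_zero => I /Fid; exact: ideal0.
- by move=> x y xy Iy I FI; apply: (ideal_down (Fid _ FI) xy); exact: Iy.
- by move=> x y Ix Iy I FI; apply: (ideal_oplus (Fid _ FI)); [exact: Ix|exact: Iy].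
Qed.

Lemma open_MaxI (U : set (MaxI E)) :
  open U <-> exists2 I, is_ideal I & U = hull_kernel I.
Proof.
split; last first.
  move=> [I idI ->]; exists [set hull_kernel I]; last by rewrite bigcup_set1.
  by move=> _ ->; exact: finI_from1.
move=> [D DE <-].
have Dop V : D V -> exists2 I, is_ideal I & V = hull_kernel I.
  move=> /DE[G GD <-]; rewrite bigcap_fset big_seq.
  apply: (big_ind (fun V => exists2 I, is_ideal I & V = @hull_kernel E I)).
  - by exists setT; [split=> //; exists emv_zero | rewrite hull_kernelT].
  - move=> _ _ [I idI ->] [J idJ ->]; exists (I `&` J); last first.
      by rewrite hull_kernelI.
    split=> [|x y xy [Iy Jy]|x y [Ix Jx] [Iy Jy]].
    + by exists emv_zero; split; exact: ideal0.
    + by split; [exact: (ideal_down idI xy) | exact: (ideal_down idJ xy)].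
    + by split; [exact: (ideal_oplus idI) | exact: (ideal_oplus idJ)].
  - by move=> I /GD; rewrite inE => idI; exists I.
exists (\bigcap_(J in [set J | is_ideal J /\
    forall I, is_ideal I -> D (hull_kernel I) -> I `<=` J]) J).
  by apply: ideal_bigcap => J [].
apply/seteqP; split=> [A [V DV VA] /= capA|A /= nA].
  have [I idI VI] := Dop _ DV; rewrite VI in DV VA.
  have : ~ (I `<=` sval A) := VA.
  by apply; apply: subset_trans capA => x Ix J [_ /(_ I idI DV)]; exact.
have mA : maximal_ideal (sval A) := svalP A.
apply: contrapT => nDA; apply: nA => x; apply; split; first exact: mA.1.1.
move=> I idI DI; apply: contrapT => IA; apply: nDA.
by exists (hull_kernel I).
Qed.
End open_MaxI.

Section mv_theory.
Variable N : mvAlgebra.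
Implicit Types x y z t : mv_sort N.
Local Notation "x (+) y" := (mv_oplus x y) (at level 50, left associativity).
Local Notation "~' x" := (mv_neg x) (at level 35, right associativity).
Local Notation one := (mv_one N).
Local Notation le := (@emv_le (mv_emv N)).

Let ax := mv_axioms N.
Let addA x y z : x (+) (y (+) z) = x (+) y (+) z. Proof. exact: (mv_addA ax). Qed.
Let addC x y : x (+) y = y (+) x. Proof. exact: (mv_addC ax). Qed.
Let add0 x : x (+) mv_zero N = x. Proof. exact: (mv_add0 ax). Qed.
Let add1 x : x (+) one = one. Proof. exact: (mv_add1 ax). Qed.
Let negK x : ~' ~' x = x. Proof. exact: (mv_negK ax). Qed.
Let neg1 : ~' one = mv_zero N. Proof. by rewrite -(mv_neg0 ax) negK. Qed.
Let joinC x y : mv_join x y = mv_join y x. Proof. exact: (mv_luk ax). Qed.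

Let addN x : ~' x (+) x = one.
Proof.
by have := joinC x one; rewrite /mv_join !add1 neg1 (addC (mv_zero N)) add0 => <-.
Qed.

Let join_le x y : mv_join x y = y <-> ~' x (+) y = one.
Proof.
split=> [<-|xy]; last by rewrite /mv_join xy neg1 addC add0.
by rewrite /mv_join (addC _ y) addA addC addN.
Qed.

Let leE x y : le x y <-> ~' x (+) y = one.
Proof.
rewrite /emv_le /= /mv_meet joinC.
have := join_le (~' y) (~' x); rewrite negK (addC y) => <-.
by split=> [e|->]; [rewrite -{2}e negK | rewrite negK].
Qed.

Let le_refl x : le x x. Proof. by apply/leE. Qed.

Let le_addr x y : le x (x (+) y).
Proof. by apply/leE; rewrite addA addN addC add1. Qed.

Let leD x y z : le x y -> le (x (+) z) (y (+) z).
Proof.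
move=> /leE /join_le; rewrite joinC /mv_join => e.
by rewrite -e -addA [X in le _ X]addC; exact: le_addr.
Qed.

Let leN x y : le x y -> le (~' y) (~' x).
Proof. by move=> /leE xy; apply/leE; rewrite negK addC. Qed.

Let le_trans y x z : le x y -> le y z -> le x z.
Proof.
move=> /leE xy /leE /join_le; rewrite joinC /mv_join => <-.
by apply/leE; rewrite addC -addA (addC y) xy add1.
Qed.

Let le_joinr x y : le y (mv_join x y).
Proof. by rewrite /mv_join addC; exact: le_addr. Qed.

Let le_joinl x y : le x (mv_join x y).
Proof. by rewrite joinC; exact: le_joinr. Qed.

Let join_lub x y z : le x z -> le y z -> le (mv_join x y) z.
Proof.
move=> xz /leE /join_le; rewrite joinC /mv_join => <-.
by apply/leD/leN/leD/leN.
Qed.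

Let le_subD x y z : le (~' (~' x (+) z)) y <-> le x (y (+) z).
Proof. by split=> /leE; rewrite ?negK => e; apply/leE; rewrite ?negK -e (addC y) addA. Qed.

Let le_meet x y z : le z x -> le z y -> le z (mv_meet x y).
Proof.
move=> /leN zx /leN zy; rewrite -[z]negK /mv_meet; apply: leN.
exact: join_lub.
Qed.

Let meet_lel x y : le (mv_meet x y) x.
Proof. by rewrite -[X in le _ X]negK; apply: leN; exact: le_joinl. Qed.

Let meet_ler x y : le (mv_meet x y) y.
Proof. by rewrite -[X in le _ X]negK; apply: leN; exact: le_joinr. Qed.

Lemma mv_subdistributive : subdistributive N.
Proof.
split.
- exact: le_refl.
- exact: le_trans.
- by move=> x; apply/leE; rewrite (mv_neg0 ax) addC add1.
- exact: meet_lel.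
- exact: meet_ler.
- exact: le_meet.
- move=> x y z; apply/(le_subD _ _ (mv_meet x z)).1; apply: le_meet.
    apply/(le_subD _ _ (mv_meet x z)).2.
    by apply: le_trans (meet_lel x _) _; exact: le_addr.
  apply/(le_subD _ _ (mv_meet x z)).2; rewrite [X in le _ X]addC.
  apply/(le_subD _ _ y).1; apply: le_meet; apply/(le_subD _ _ y).2.
    by apply: le_trans (meet_lel x _) _; exact: le_addr.
  by rewrite addC; exact: meet_ler.
Qed.

Lemma open_MaxI_mv (U : set (MaxI N)) :
  open U <-> exists2 I, is_ideal I & U = hull_kernel I.
Proof. exact: (open_MaxI mv_subdistributive). Qed.

Lemma open_MaxI_sub (M : set N) (subM : is_emv_subalgebra M)
    (U : set (MaxI (sub_emv subM))) :
  open U <-> exists2 I, is_ideal I & U = hull_kernel I.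
Proof.
have [/= le_refl' tr l0 ml mr mI mD] := mv_subdistributive.
have leS (x y : sub_emv subM) : emv_le x y <-> le (val x) (val y).
  by split=> [/(congr1 val)|] //= xy; exact: val_inj.
apply: open_MaxI; split.
- by move=> x; apply/leS; exact: le_refl'.
- by move=> y x z /leS xy /leS yz; apply/leS; exact: tr yz.
- by move=> x; apply/leS; exact: l0.
- by move=> x y; apply/leS; exact: ml.
- by move=> x y; apply/leS; exact: mr.
- by move=> x y z /leS zx /leS zy; apply/leS; exact: mI.
- by move=> x y z; apply/leS; exact: mD.
Qed.

End mv_theory.

Definition homeomorphic (X Y : topologicalType) : Prop :=
  exists (f : X -> Y) (g : Y -> X),
    [/\ cancel f g, cancel g f, continuous f & continuous g].

(* The non-compactness of [X] says that [X] is dense in its one-point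
   compactification; that [Y] is Hausdorff amounts to [X] being Hausdorff and
   locally compact. *)
Definition is_one_point_compactification (X Y : topologicalType) : Prop :=
  [/\ hausdorff_space Y, ~ compact [set: X] &
      homeomorphic (one_point_compactification X) Y].

(* Main.v *)
Require Import Defs.
From mathcomp Require Import all_boot all_order all_algebra.
From mathcomp Require Import all_classical all_reals all_analysis.
From mathcomp Require Import zify lra.
Import Defs.
Import Order.TTheory GRing.Theory Num.Theory.
Import numFieldNormedType.Exports.

Set Implicit Arguments.
Unset Strict Implicit.
Unset Printing Implicit Defensive.

(** Both halves rest on one topological fact: if [Y] is compact Hausdorff and
    [r : X -> Y] is an open embedding whose range is [Y] minus a non-isolated
    point, then [Y] is the one-point compactification of [X]
    ([open_embedding_one_point_compactification]). The missing point is the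
    maximal ideal [M] in [MaxI N], and in [SM N] the only state-morphism that
    vanishes on [M].

    The embeddings. A state-morphism [s] of [M] takes the value [1] at some
    idempotent [a] of [M], and [x |-> x /\ a] is a homomorphism of [N] onto
    [[0,a]], so [x |-> s (x /\ a)] extends [s] to [N]. As every element of [N]
    lies in [M] or has its complement there, a state-morphism of [N] is
    determined by its restriction to [M]; the restriction is a state-morphism of
    [M] unless it is zero. For ideals, restriction [A |-> A /\ M] and extension
    [B |-> {x | x /\ m in B for all m in M}] are adjoint, and they are inverse to
    each other on the maximal ideals other than [M].

    Compactness. [SM N] is closed in a power of the unit interval. Taking
    kernels is a continuous map [SM N -> MaxI N], and it is onto because the
    quotient of [N] by a maximal ideal embeds in the unit interval
    ([state_of_maximal_ideal]). That is a form of Hoelder's theorem: for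
    [e] outside the maximal ideal [A], count how many copies of [e] are needed
    to cover [x] modulo [A], and divide by the count for [one]. This is a
    homomorphism up to an error that is zero if [e] is an atom modulo [A] and
    tends to zero with [e] otherwise; a cluster point in the power of the unit
    interval is an exact homomorphism. [MaxI N] is Hausdorff because
    [(x - y) /\ (y - x) = 0] and maximal ideals are prime.

    The point at infinity is not isolated. As [M] has no top, for every
    idempotent [a] of [M] there is an element of [M] not below [a], hence a
    state-morphism of [N] that vanishes at [a] but not on [M]
    ([state_vanishing_at]). These sets of state-morphisms form a filter, whose
    only cluster point is the state-morphism vanishing on [M]. For [MaxI N] the
    claim follows along the kernel map. *)

Local Open Scope classical_set_scope.

Local Notation "x (+) y" := (mv_oplus x y) (at level 50, left associativity).
Local Notation "~' x" := (mv_neg x) (at level 35, right associativity).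

(** Truncated subtraction: on the unit interval it is [max (x - y) 0]. *)
Definition mv_sub (N : mvAlgebra) (x y : mv_sort N) : mv_sort N :=
  ~' (~' x (+) y).

Local Notation "x (-) y" := (mv_sub x y) (at level 50, left associativity).

(** * Truncated subtraction in MV-algebras *)

Section mv_arithmetic.
Variable N : mvAlgebra.
Implicit Types a b x y z : mv_sort N.
Local Notation zero := (mv_zero N).
Local Notation one := (mv_one N).
Local Notation le := (@emv_le N).

Let ax := mv_axioms N.

Lemma mv_addrA x y z : x (+) (y (+) z) = x (+) y (+) z.
Proof. exact: (mv_addA ax). Qed.
Lemma mv_addrC x y : x (+) y = y (+) x. Proof. exact: (mv_addC ax). Qed.
Lemma mv_addr0 x : x (+) zero = x. Proof. exact: (mv_add0 ax). Qed.
Lemma mv_add0r x : zero (+) x = x. Proof. by rewrite mv_addrC mv_addr0. Qed.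
Lemma mv_addr1 x : x (+) one = one. Proof. exact: (mv_add1 ax). Qed.
Lemma mv_opprK x : ~' ~' x = x. Proof. exact: (mv_negK ax). Qed.
Lemma mv_oppr0 : ~' zero = one. Proof. exact: (mv_neg0 ax). Qed.
Lemma mv_oppr1 : ~' one = zero. Proof. by rewrite -mv_oppr0 mv_opprK. Qed.
Lemma mv_joinC x y : mv_join x y = mv_join y x. Proof. exact: (mv_luk ax). Qed.
Lemma mv_meetC x y : mv_meet x y = mv_meet y x.
Proof. by rewrite /mv_meet mv_joinC. Qed.

Lemma mv_addNr x : ~' x (+) x = one.
Proof.
have := mv_joinC x one.
by rewrite /mv_join !mv_addr1 mv_oppr1 mv_add0r => <-.
Qed.

Lemma mv_leE x y : le x y <-> x (-) y = zero.
Proof.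
rewrite /mv_sub -mv_oppr1; split=> [<-|/(congr1 (@mv_neg N))]; last first.
  rewrite !mv_opprK /emv_le /= mv_meetC /mv_meet /mv_join mv_opprK.
  by move=> xy; rewrite (mv_addrC y) xy mv_oppr1 mv_add0r mv_opprK.
by rewrite /= /mv_meet mv_opprK /mv_join -mv_addrA mv_addNr mv_addr1.
Qed.

Let sd := mv_subdistributive N.

Lemma mv_le_refl x : le x x. Proof. exact: (sd_refl sd). Qed.
Lemma mv_le_trans y x z : le x y -> le y z -> le x z.
Proof. exact: (sd_trans sd). Qed.
Lemma mv_le_anti x y : le x y -> le y x -> x = y.
Proof.
rewrite /emv_le /= => xy yx.
by rewrite -[LHS]xy mv_meetC yx.
Qed.
Lemma mv_le0 x : le zero x. Proof. exact: (sd_le0 sd). Qed.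
Lemma mv_le1 x : le x one.
Proof. by apply/mv_leE; rewrite /mv_sub mv_addr1 mv_oppr1. Qed.

Lemma mv_subrA x y z : x (-) y (-) z = x (-) (y (+) z).
Proof. by rewrite /mv_sub mv_opprK mv_addrA. Qed.

Lemma mv_subr0 x : x (-) zero = x.
Proof. by rewrite /mv_sub mv_addr0 mv_opprK. Qed.

Lemma mv_sub1r x : one (-) x = ~' x.
Proof. by rewrite /mv_sub mv_oppr1 mv_add0r. Qed.

Lemma mv_le_subl x y z : le (x (-) y) z <-> le x (z (+) y).
Proof.
have e : x (-) y (-) z = x (-) (z (+) y) by rewrite mv_subrA (mv_addrC z).
by split=> /mv_leE xz; apply/mv_leE; [rewrite -e | rewrite e].
Qed.

Lemma mv_le_addr x y : le x (x (+) y).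
Proof. by apply/mv_leE;
  rewrite /mv_sub mv_addrA mv_addNr mv_addrC mv_addr1 mv_oppr1. Qed.

Lemma mv_le_addl x y : le x (y (+) x).
Proof. by rewrite mv_addrC; exact: mv_le_addr. Qed.

Lemma mv_le_subr_id x y : le (x (-) y) x.
Proof. by apply/mv_le_subl; exact: mv_le_addr. Qed.

Lemma mv_le_sub_add x y : le x (x (-) y (+) y).
Proof. by apply/mv_le_subl; exact: mv_le_refl. Qed.

Lemma mv_le_add2r z x y : le x y -> le (x (+) z) (y (+) z).
Proof.
move=> /mv_leE xy; have := mv_joinC y x.
rewrite /mv_join -/(x (-) y) xy mv_add0r => <-.
by rewrite -mv_addrA; exact: mv_le_addl.
Qed.

Lemma mv_le_add x y z t : le x y -> le z t -> le (x (+) z) (y (+) t).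
Proof.
move=> xy zt; apply: (@mv_le_trans (y (+) z)); first exact: mv_le_add2r.
by rewrite (mv_addrC _ z) (mv_addrC _ t); exact: mv_le_add2r.
Qed.

Lemma mv_le_opp x y : le x y -> le (~' y) (~' x).
Proof. by move=> /mv_leE xy; apply/mv_leE;
  rewrite -xy /mv_sub mv_opprK mv_addrC. Qed.

Lemma mv_meetE x y : mv_meet x y = y (-) (y (-) x).
Proof.
by rewrite /mv_meet /mv_join /mv_sub mv_opprK mv_addrC (mv_addrC x).
Qed.

Lemma mv_meetEN x y : mv_meet x (~' y) = (x (+) y) (-) y.
Proof. by rewrite /mv_meet /mv_join !mv_opprK. Qed.

Lemma mv_joinE x y : mv_join x y = x (-) y (+) y. Proof. by []. Qed.

Lemma mv_le_meet x y z : le z x -> le z y -> le z (mv_meet x y).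
Proof. exact: (sd_meet sd). Qed.
Lemma mv_le_meetl x y : le (mv_meet x y) x. Proof. exact: (sd_meetl sd). Qed.
Lemma mv_le_meetr x y : le (mv_meet x y) y. Proof. exact: (sd_meetr sd). Qed.
Lemma mv_meet_add x y z :
  le (mv_meet x (y (+) z)) (mv_meet x y (+) mv_meet x z).
Proof. exact: (sd_meet_add sd). Qed.

Lemma mv_le0E x : le x zero -> x = zero.
Proof. by move=> /mv_le_anti; apply; exact: mv_le0. Qed.

Lemma mv_le_sub2l x y z : le y z -> le (x (-) z) (x (-) y).
Proof.
move=> yz; apply/mv_le_subl; apply: mv_le_trans (mv_le_sub_add x y) _.
by apply: mv_le_add yz; exact: mv_le_refl.
Qed.

Lemma mv_subrr x : x (-) x = zero.
Proof. by apply/mv_leE; exact: mv_le_refl. Qed.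

Lemma mv_meet_idl x y : le x y -> mv_meet x y = x. Proof. by []. Qed.

(** As [y (-) x] lies below the complement of [x], adding it to [x] loses nothing
    and it can be subtracted again. *)
Lemma mv_join_subr x y : mv_join x y (-) (y (-) x) = x.
Proof.
rewrite mv_joinC mv_joinE [in X in X (-) _]mv_addrC -mv_meetEN.
apply: mv_meet_idl; rewrite -[X in le X _]mv_opprK; apply: mv_le_opp.
apply/mv_le_subl; rewrite mv_addNr; exact: mv_le1.
Qed.

Lemma mv_join_lub x y z : le x z -> le y z -> le (mv_join x y) z.
Proof.
move=> xz /mv_leE yz; apply: (@mv_le_trans (mv_join z y)).
  by apply/mv_le_add2r/mv_le_subl/(mv_le_trans xz); exact: mv_le_sub_add.
by rewrite mv_joinC mv_joinE yz mv_add0r; exact: mv_le_refl.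
Qed.

(** By [mv_join_subr], subtracting the meet [w] from [z = x \/ y] leaves something
    above [x] and above [y], hence above [z]; so [w = z (-) (z (-) w)] vanishes. *)
Lemma mv_prelinear x y : mv_meet (x (-) y) (y (-) x) = zero.
Proof.
set w := mv_meet _ _; set z := mv_join x y.
have xz : le x (z (-) w).
  by rewrite -[X in le X _](mv_join_subr x y); exact/mv_le_sub2l/mv_le_meetr.
have yz : le y (z (-) w).
  rewrite -[X in le X _](mv_join_subr y x) mv_joinC.
  by apply/mv_le_sub2l; exact: mv_le_meetl.
have zz : le z (z (-) w) by exact: mv_join_lub.
have wz : le w z.
  by apply: mv_le_trans (mv_le_meetl _ _) _; exact: mv_le_addr.
apply: mv_le0E; rewrite -[X in le X _](mv_meet_idl wz) mv_meetE.
by apply/mv_le_subl; rewrite mv_add0r.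
Qed.

Lemma mv_idem_meetN a : emv_idem (a : N) -> mv_meet a (~' a) = zero.
Proof.
by move=> aa; rewrite mv_meetEN [X in X (-) _]aa mv_subrr.
Qed.

(** The element [(a (+) a) (-) a] is the meet of [a] and its complement, which is
    symmetric in the two. *)
Lemma mv_idemN a : emv_idem (a : N) -> emv_idem (~' a : N).
Proof.
move=> aa; apply: mv_le_anti; last exact: mv_le_addr.
apply/mv_leE; rewrite -mv_meetEN mv_opprK mv_meetC.
exact: mv_idem_meetN.
Qed.

Lemma mv_idemD a b : emv_idem (a : N) -> emv_idem (b : N) ->
  emv_idem (a (+) b : N).
Proof.
rewrite /emv_idem /= => aa bb.
by rewrite mv_addrA -(mv_addrA a) (mv_addrC b) mv_addrA aa -mv_addrA bb.
Qed.

(** This makes the relation [is_lambda] computable: a map that preserves [(+)] and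
    the complement preserves it. *)
Lemma mv_is_lambdaP b x z : le x b ->
  is_lambda (b : N) x z <-> z = b (-) x.
Proof.
move=> xb; have lam : is_lambda (b : N) x (b (-) x).
  split=> [|/=|w _ /= wx]; first exact: mv_le_subr_id.
  - by rewrite -mv_joinE mv_joinC mv_joinE (mv_leE x b).1 // mv_add0r.
  - by apply/mv_le_subl; rewrite wx; exact: mv_le_refl.
split=> [[zb zx zmin]|-> //]; have [lb lx lmin] := lam.
by apply: mv_le_anti; [exact: zmin | exact: lmin].
Qed.

Lemma mv_is_lambda1 x : is_lambda (one : N) x (~' x).
Proof. by apply/(mv_is_lambdaP _ (mv_le1 x)); rewrite mv_sub1r. Qed.

End mv_arithmetic.

(** * Ideals of MV-algebras *)

Section mv_ideals.
Variable N : mvAlgebra.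
Implicit Types (x y z : mv_sort N) (A I : set N).
Local Notation zero := (mv_zero N).
Local Notation one := (mv_one N).
Local Notation le := (@emv_le N).

Lemma mv_ideal0 I : is_ideal I -> I zero.
Proof.
by move=> idI; have [x] := ideal_neq0 idI; apply: (ideal_down idI); exact: mv_le0.
Qed.

Lemma mv_properP I : is_ideal I -> proper_ideal I <-> ~ I one.
Proof.
move=> idI; split=> [[_ /eqP nT] I1|nI1].
  by apply: nT; apply/seteqP; split=> // x _; apply: (ideal_down idI) I1;
    exact: mv_le1.
by split=> //; apply/eqP => IT; apply: nI1; rewrite IT.
Qed.

(** Zorn's lemma is applied to the sets [J] such that [I `|` J] is a proper ideal,
    rather than to the proper ideals containing [I], so that the union of the
    empty chain qualifies. *)
Lemma mv_proper_sub_maximal I : proper_ideal I ->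
  exists2 A, maximal_ideal A & I `<=` A.
Proof.
move=> pI; pose P J := proper_ideal (I `|` J).
have [F FP Ftot|J [PJ maxJ]] := @Zorn_bigcup N P; last first.
  exists (I `|` J); last exact: subsetUl.
  split=> // K pK IJK; apply/seteqP; split=> // x Kx.
  have PK : P K.
    by rewrite /P setUidr//; apply: subset_trans IJK; exact: subsetUl.
  right; apply: contrapT => nJx; apply: (maxJ K) PK; split.
    by apply: subset_trans IJK; exact: subsetUr.
  by move=> /(_ x Kx).
have sub X : F X -> I `|` X `<=` I `|` \bigcup_(X in F) X.
  by move=> FX; apply: setUS; exact: bigcup_sup.
have [idI _] := pI.
have idU : is_ideal (I `|` \bigcup_(X in F) X).
  split; first by have [x Ix] := ideal_neq0 idI; exists x; left.
  - move=> x y xy [Iy|[X FX Xy]]; first by left; exact: (ideal_down idI) Iy.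
    by apply: (sub X) => //; apply: (ideal_down (FP X FX).1 xy); right.
  - move=> x y [Ix|[X FX Xx]] [Iy|[Y FY Yy]].
    + by left; exact: (ideal_oplus idI).
    + by apply: (sub Y) => //; apply: (ideal_oplus (FP Y FY).1); [left|right].
    + by apply: (sub X) => //; apply: (ideal_oplus (FP X FX).1); [right|left].
    + have [XY|YX] := Ftot X Y FX FY.
        by apply: (sub Y) => //; apply: (ideal_oplus (FP Y FY).1); right => //;
          exact: XY.
      by apply: (sub X) => //; apply: (ideal_oplus (FP X FX).1); right => //;
        exact: YX.
apply/(mv_properP idU) => -[|[X FX X1]]; first exact/(mv_properP idI).
by have [idX _] := FP X FX; have /(mv_properP idX) := FP X FX; apply; right.
Qed.

End mv_ideals.

(** * Counting copies of an element modulo a maximal ideal *)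

Section counting.
Variables (N : mvAlgebra) (A : set N) (maxA : maximal_ideal A).
Implicit Types x y z e : mv_sort N.
Local Notation zero := (mv_zero N).
Local Notation one := (mv_one N).
Local Notation le := (@emv_le N).

Let idA : is_ideal A := maxA.1.1.

(** The order of the quotient of [N] by [A], as a preorder on [N]. Since [A] is
    prime it is total, and since [A] is maximal it is archimedean. *)
Definition leA x y := A (x (-) y).
Definition mv_muln n x := iter n (mv_oplus x) zero.

Lemma leA_le x y : le x y -> leA x y.
Proof. by move=> /mv_leE; rewrite /leA => ->; exact: mv_ideal0. Qed.

Lemma leA_refl x : leA x x. Proof. exact/leA_le/mv_le_refl. Qed.

Lemma leA_trans y x z : leA x y -> leA y z -> leA x z.
Proof.
move=> xy yz; apply: (ideal_down idA) (ideal_oplus idA xy yz).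
apply/mv_le_subl => /=; rewrite -mv_addrA; apply: mv_le_trans (mv_le_sub_add x y) _.
by apply: mv_le_add; [exact: mv_le_refl | exact: mv_le_sub_add].
Qed.

Lemma leA_add2r z x y : leA x y -> leA (x (+) z) (y (+) z).
Proof.
apply: (ideal_down idA); apply/mv_le_subl; rewrite mv_addrA.
by apply: mv_le_add2r; exact: mv_le_sub_add.
Qed.

Lemma leA_add x y z t : leA x y -> leA z t -> leA (x (+) z) (y (+) t).
Proof.
move=> xy zt; apply: (@leA_trans (y (+) z)); first exact: leA_add2r.
by rewrite (mv_addrC _ z) (mv_addrC _ t); exact: leA_add2r.
Qed.

Lemma leA_subl x y z : leA (x (-) y) z <-> leA x (z (+) y).
Proof. by rewrite /leA mv_subrA mv_addrC. Qed.

Lemma leA_total x y : leA x y \/ leA y x.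
Proof.
apply: (maximal_ideal_prime (mv_subdistributive N) maxA) => /=.
by rewrite mv_prelinear; exact: mv_ideal0.
Qed.

Lemma leA0 x : leA x zero <-> A x. Proof. by rewrite /leA mv_subr0. Qed.

Lemma leA1N x : leA one x <-> A (~' x).
Proof. by rewrite /leA mv_sub1r. Qed.

Lemma leA1_add x y : leA one (x (+) y) <-> leA (~' x) y.
Proof. by rewrite mv_addrC -leA_subl mv_sub1r. Qed.

Lemma leA_subrK x y : leA y x -> leA (x (-) y (+) y) x.
Proof.
move=> yx; rewrite -mv_joinE mv_joinC mv_joinE -[X in leA _ X]mv_add0r.
by apply: leA_add2r; apply/leA0.
Qed.

(** The hypothesis [leA y (~' x)] says that the sum [x (+) y] does not overflow:
    then [y] is recovered modulo [A] as [(x (+) y) (-) x]. *)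
Lemma leA_cancel x y z : leA y (~' x) -> leA (x (+) y) (x (+) z) -> leA y z.
Proof.
move=> Ad xyz; apply: (@leA_trans (y (+) x (-) x)).
  rewrite -mv_meetEN mv_meetC mv_meetE; set d := y (-) ~' x.
  apply: (@leA_trans (y (-) d (+) d)); first exact/leA_le/mv_le_sub_add.
  rewrite -[X in leA _ X]mv_addr0; apply: leA_add; first exact: leA_refl.
  exact/leA0.
by apply/leA_subl; rewrite mv_addrC (mv_addrC z).
Qed.

Lemma mv_mulnS n x : mv_muln n.+1 x = x (+) mv_muln n x. Proof. by []. Qed.

Lemma mv_mulnD n m x : mv_muln (n + m) x = mv_muln n x (+) mv_muln m x.
Proof.
elim: n => [|n IHn]; first by rewrite mv_add0r.
by rewrite addSn !mv_mulnS IHn mv_addrA.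
Qed.

Lemma leA_muln_le n m x : (n <= m)%N -> leA (mv_muln n x) (mv_muln m x).
Proof. by move=> /subnKC <-; rewrite mv_mulnD; exact/leA_le/mv_le_addr. Qed.

Lemma leA_muln n x y : leA x y -> leA (mv_muln n x) (mv_muln n y).
Proof.
move=> xy; elim: n => [|n IHn]; first exact: leA_refl.
by rewrite !mv_mulnS; exact: leA_add.
Qed.

(** The elements covered modulo [A] by a multiple of [e] form an ideal that
    contains [A] and [e]; by maximality it is everything. *)
Lemma leA_archimedean e : ~ A e -> exists n, leA one (mv_muln n e).
Proof.
move=> nAe; pose J : set N := [set z | exists n, leA z (mv_muln n e)].
have idJ : is_ideal J.
  split; first by exists zero, 0%N; exact: leA_refl.
  - by move=> x y /leA_le xy [n yn]; exists n; exact: leA_trans yn.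
  - by move=> x y [n xn] [m ym]; exists (n + m)%N; rewrite mv_mulnD; exact: leA_add.
apply: contrapT => nJ1.
have JA : J = A.
  apply: maxA.2; first exact/(mv_properP idJ).
  by move=> x Ax; exists 0%N; exact/leA0.
apply: nAe; rewrite -JA; exists 1%N.
by rewrite /= /mv_muln /= mv_addr0; exact: leA_refl.
Qed.

Lemma leA_one_notin : ~ leA one zero.
Proof. by move=> /leA0; apply/(mv_properP idA); exact: maxA.1. Qed.

Section height.
Variables (e : mv_sort N) (nAe : ~ A e).

Let ex_height x : exists n, `[< leA x (mv_muln n e) >].
Proof.
have [n en] := leA_archimedean nAe.
by exists n; apply/asboolP; apply: leA_trans en; exact/leA_le/mv_le1.
Qed.

(** The covering number of [x] by copies of [e], modulo [A]. *)
Definition height x := ex_minn (ex_height x).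

Lemma height_le x : leA x (mv_muln (height x) e).
Proof. by rewrite /height; case: ex_minnP => n /asboolP. Qed.

Lemma height_min n x : leA x (mv_muln n e) -> (height x <= n)%N.
Proof.
by move=> xn; rewrite /height; case: ex_minnP => m _; apply; exact/asboolP.
Qed.

Lemma height_mono x y : leA x y -> (height x <= height y)%N.
Proof. by move=> xy; apply: height_min; apply: leA_trans xy (height_le y). Qed.

Lemma height_ideal x : A x -> height x = 0%N.
Proof. by move=> Ax; apply/eqP; rewrite -leqn0 height_min//; exact/leA0. Qed.

Lemma height1_gt0 : (0 < height one)%N.
Proof.
have := height_le one; case: (height one) => // h1.
by case: (leA_one_notin h1).
Qed.

Lemma height_le1 x : (height x <= height one)%N.
Proof. exact/height_mono/leA_le/mv_le1. Qed.

Lemma height_add x y : (height (x (+) y) <= height x + height y)%N.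
Proof.
by apply: height_min; rewrite mv_mulnD; apply: leA_add; exact: height_le.
Qed.

(** Covering numbers are subadditive. They are superadditive up to [d] on sums that
    do not overflow, where [d] bounds how far the covering of an element may
    exceed the copies of [e] that fit below it: [1] in general, and [0] if [e] is
    an atom modulo [A]. *)
Section defect.
Variable d : nat.
Hypothesis below : forall x,
  exists2 p, leA (mv_muln p e) x & (height x <= p + d)%N.

Lemma height_superadd x y : leA y (~' x) ->
  (height x + height y <= height (x (+) y) + d)%N.
Proof.
move=> yx; have [->|y0] := posnP (height y).
  by rewrite addn0 (leq_trans (height_mono (leA_le (mv_le_addr x y))))// leq_addr.
have [p px hx] := below x; set k := height (x (+) y).
rewrite leqNgt; apply/negP => lt_k.
(* [p] copies of [e] fit below [x], so the other [k - p] must cover [y]. *)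
suff : (height y <= k - p)%N by lia.
apply/height_min/(leA_cancel yx)/(leA_trans (height_le _)); rewrite -/k.
apply: (@leA_trans (mv_muln (p + (k - p)) e)); first by apply: leA_muln_le; lia.
by rewrite mv_mulnD; exact: leA_add2r.
Qed.

(** Either [x (+) y] does not overflow, or it equals [one] modulo [A]. *)
Lemma height_add_ge x y :
  (minn (height one) (height x + height y) <= height (x (+) y) + d)%N.
Proof.
have [yx|xy] := leA_total y (~' x).
  by rewrite geq_min height_superadd ?orbT.
rewrite geq_min (leq_trans (height_mono _) (leq_addr _ _))//.
exact/leA1_add.
Qed.

Lemma height_opp x : (height one <= height x + height (~' x) <= height one + d)%N.
Proof.
apply/andP; split.
  apply: leq_trans (height_add _ _); apply: height_mono.
  by rewrite mv_addrC mv_addNr; exact: leA_refl.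
apply: leq_trans (height_superadd (leA_refl _)) _.
by rewrite leq_add2r height_le1.
Qed.

End defect.

Lemma height_below1 x :
  exists2 p, leA (mv_muln p e) x & (height x <= p + 1)%N.
Proof.
exists (height x).-1; last by rewrite addn1 leqSpred.
have := @height_min (height x).-1 x; case: (height x) => [_|n /=].
  exact/leA_le/mv_le0.
rewrite ltnn => nx; have [//|/nx//] := leA_total (mv_muln n e) x.
Qed.

(** The part of [x] beyond the first [height x - 1] copies of an atom [e] is
    nonzero and below [e], so it is [e] modulo [A]. *)
Lemma height_below0 : (forall x, ~ A x -> leA x e -> leA e x) ->
  forall x, exists2 p, leA (mv_muln p e) x & (height x <= p + 0)%N.
Proof.
move=> atom x; exists (height x); last by rewrite addn0.
have := @height_min (height x).-1 x; have := height_le x.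
case: (height x) => [_ _|n xn].
  exact/leA_le/mv_le0.
rewrite succnK ltnn => nx.
have le_nx : leA (mv_muln n e) x by have [//|/nx//] := leA_total (mv_muln n e) x.
apply: leA_trans (leA_subrK le_nx); rewrite mv_mulnS; apply: leA_add2r.
apply: atom; last exact: (leA_subl _ _ _).2 xn.
by move=> /leA0/leA_subl; rewrite mv_add0r => /nx.
Qed.

End height.

(** If [n] copies of [e] fall short of [one] by [t], then an element strictly below
    the smaller of [t] and [e] has its first [n+1] copies short of [one]. *)
Lemma small_elements :
  (forall e, ~ A e -> exists2 x, ~ A x & leA x e /\ ~ leA e x) ->
  forall n, exists2 e, ~ A e & ~ leA one (mv_muln n e).
Proof.
move=> noatom; elim=> [|n [e nAe ne]].
  exists one; last exact: leA_one_notin.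
  by apply/(mv_properP idA); exact: maxA.1.
pose t := ~' mv_muln n e.
have nAt : ~ A t by rewrite -leA1N.
have [u nAu [ut ue]] : exists2 u, ~ A u & leA u t /\ leA u e.
  have [te|et] := leA_total t e.
    by exists t => //; split=> //; exact: leA_refl.
  by exists e => //; split=> //; exact: leA_refl.
have [x nAx [xu nux]] := noatom u nAu; exists x => // n1.
apply: nux; apply: leA_trans ut _; apply/leA1_add; apply: leA_trans n1 _.
rewrite mv_mulnS mv_addrC; apply: leA_add2r.
by apply: leA_muln; exact: leA_trans ue.
Qed.

(** After division by [H] the error [d / H] is at most [1 / k]: either an atom
    gives [d = 0], or [d = 1] and [H] is made at least [k] by a small [e]. *)
Lemma approx_additive (k : nat) : exists (h : N -> nat) (H d : nat),
  [/\ (0 < H)%N, (k * d <= H)%N,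
    (forall x, A x -> h x = 0%N) /\ (forall x, h x <= H)%N,
    (forall x, H <= h x + h (~' x) <= H + d)%N &
    forall x y, (h (x (+) y) <= h x + h y /\
      minn H (h x + h y) <= h (x (+) y) + d)%N].
Proof.
have [[e [nAe atom]]|noatom] := pselect (exists e, ~ A e /\
    forall x, ~ A x -> leA x e -> leA e x).
  have low := height_below0 nAe atom.
  exists (height nAe), (height nAe one), 0%N; split.
  - exact: height1_gt0.
  - by rewrite muln0.
  - by split=> x; [exact: height_ideal | exact: height_le1].
  - by move=> x; exact: height_opp.
  - by move=> x y; split; [exact: height_add | exact: height_add_ge].
have [|e nAe ke] := @small_elements _ k.
  move=> e nAe; apply: contrapT => ne; apply: noatom; exists e; split=> // x nAx xe.
  by apply: contrapT => ex; apply: ne; exists x.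
have low := height_below1 nAe.
exists (height nAe), (height nAe one), 1%N; split.
- exact: height1_gt0.
- rewrite muln1 leqNgt; apply/negP => /ltnW h1k; apply: ke.
  apply: leA_trans (height_le nAe one) _; exact: leA_muln_le.
- by split=> x; [exact: height_ideal | exact: height_le1].
- by move=> x; exact: height_opp.
- by move=> x y; split; [exact: height_add | exact: height_add_ge].
Qed.

End counting.

(** * One-point compactification by an open embedding *)

Lemma compact_subtype (X : topologicalType) (A : set X) :
  compact A -> compact [set: A].
Proof.
move=> cA F PF _.
have FA : (set_val @ F) A by apply: (@filterS _ F _ setT) => [x _|];
  [exact: set_valP | exact: filterT].
have [x [Ax clx]] := cA (set_val @ F) _ FA.
exists (SigSub (mem_set Ax)); split=> // B C FB [_ [[W oW <-] Wx] WC].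
have FVB : (set_val @ F) (set_val @` B) by exact: filterS (@preimage_image _ _
  set_val B) FB.
have [_ [[z Bz <-] Wz]] := clx _ W FVB (open_nbhs_nbhs (conj oW Wx)).
by exists z; split=> //; exact: WC.
Qed.

Section one_point.
Variables (X Y : topologicalType) (r : X -> Y) (y0 : Y).
Hypotheses (hY : hausdorff_space Y) (cY : compact [set: Y]).
Hypotheses (cr : continuous r) (rI : injective r).
Hypothesis ropen : forall U, open U -> open (r @` U).
Hypothesis rrange : range r = ~` [set y0].

(** Openness and injectivity of [r] pull cluster points back from [Y] to [X]. *)
Lemma compact_open_embedding (C : set X) : closed (r @` C) -> compact C.
Proof.
move=> clC F PF FC.
have cC : compact (r @` C) by apply: (subclosed_compact clC cY).
have [|_ [[x Cx <-] clx]] := cC (r @ F) _;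
  first exact: filterS (@preimage_image _ _ r C) FC.
exists x; split=> // B W FB; rewrite nbhsE => -[V [oV Vx] VW].
have FVB : (r @ F) (r @` B) by exact: filterS (@preimage_image _ _ r B) FB.
have rV : nbhs (r x) (r @` V).
  by apply: open_nbhs_nbhs; split; [exact: ropen | exists x].
by have [_ [[z Bz <-] [v Vv /rI vz]]] := clx _ _ FVB rV; exists z; split=> //;
  apply: VW; rewrite -vz.
Qed.

Let f (z : one_point_compactification X) : Y := if z is Some x then r x else y0.

Let ry0 x : r x <> y0.
Proof. by have : (~` [set y0]) (r x) by rewrite -rrange; exists x. Qed.

Let fI : injective f.
Proof.
move=> [x|] [x'|] //= e; first by rewrite (rI e).
  by case: (ry0 e).
by case: (@ry0 x').
Qed.

Let fsurj y : exists z, f z = y.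
Proof.
have [->|yy0] := pselect (y = y0); first by exists None.
by have [x _ <-] : range r y; [rewrite rrange | exists (Some x)].
Qed.

Let fcont : continuous f.
Proof.
move=> [x|]; first exact: cr.
(* Neighborhoods of the added point are complements of closed compact sets, and
   the complement of an open neighborhood [B] of [y0] pulls back to one. *)
move=> A; rewrite nbhsE => -[B [oB By0] BA].
have clB : closed (~` B) by exact: open_closedC.
exists (r @^-1` (~` B)).
  split; last exact: closed_comp.
  apply: compact_open_embedding; rewrite (_ : r @` _ = ~` B)//.
  apply/seteqP; split=> [_ [x /= nBx <-]//|y nBy].
  have [x _ xy] : range r y by rewrite rrange => yy0; apply: nBy; rewrite yy0.
  by exists x; rewrite /= ?xy.
by move=> _ [[x nBx <-]|->]; apply: BA => //=; apply: contrapT.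
Qed.

Lemma open_embedding_one_point_compactification :
  ~ open [set y0] -> is_one_point_compactification X Y.
Proof.
move=> ny0; split=> //.
  move=> cX; apply: ny0; rewrite -[[set y0]]setCK -rrange; apply: closed_openC.
  by apply: compact_closed => //; apply: continuous_compact => //;
    exact: continuous_subspaceT.
have /choice[g gK] := fsurj.
exists f, g; split=> //; first by move=> z; apply: fI; rewrite gK.
apply/continuous_closedP => C clC; rewrite (_ : g @^-1` C = f @` C).
  apply: compact_closed => //; apply: continuous_compact;
    first exact: continuous_subspaceT.
  by apply: subclosed_compact clC one_point_compactification_compact _.
apply/seteqP; split=> [y Cy|_ [z Cz <-]]; first by exists (g y).
by rewrite /= (_ : g (f z) = z)//; apply: fI; rewrite gK.
Qed.

End one_point.

Local Open Scope ring_scope.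

(** * Powers of the unit interval *)

Section unit_interval_algebra.
Variable R : realType.
Implicit Types x y : mv_sort (unit_mv R).

Lemma unit_itv_bounds (x : unit_itv R) : 0 <= sval x <= 1.
Proof. exact: set_valP x. Qed.

Lemma unit_oplusE x y : sval (x (+) y) = Num.min (sval x + sval y) 1.
Proof. by []. Qed.

Lemma unit_oppE x : sval (~' x) = 1 - sval x. Proof. by []. Qed.

Lemma unit_subE x y : sval (x (-) y) = Num.max (sval x - sval y) 0.
Proof.
rewrite /mv_sub unit_oppE unit_oplusE unit_oppE.
by rewrite minEle maxEle; do !case: ifP => /=; lra.
Qed.

Lemma unit_meetE x y : sval (mv_meet x y) = Num.min (sval x) (sval y).
Proof.
have /andP[x0 x1] := unit_itv_bounds x; have /andP[y0 y1] := unit_itv_bounds y.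
rewrite mv_meetE !unit_subE.
by rewrite minEle !maxEle; do !case: ifP => /=; lra.
Qed.

Lemma unit_itv_compact : compact [set: unit_itv R].
Proof.
apply: compact_subtype.
rewrite (_ : [set x | _] = `[0, 1]%classic); first exact: segment_compact.
by apply/seteqP; split=> x /=; rewrite in_itv.
Qed.

End unit_interval_algebra.

Section unit_powers.
Variables (R : realType) (E : Type).
Local Notation cube := (prod_topology (fun _ : E => unit_itv R)).

(** The index type of [tychonoff] must have decidable equality, which
    [{classic E}] provides on any [E]. *)
Lemma cube_compact : compact [set: cube].
Proof.
have := @tychonoff {classic E} (fun=> unit_itv R) (fun=> setT)
  (fun=> @unit_itv_compact R).
congr (compact _); by apply/seteqP.
Qed.

Lemma cube_proj_continuous (x : E) : continuous (fun f : cube => f x).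
Proof. exact: (@proj_continuous {classic E} (fun=> unit_itv R) x). Qed.

Lemma cube_ev_continuous (x : E) : continuous (fun f : cube => sval (f x) : R).
Proof.
move=> f; apply: (@continuous_comp _ _ _ (fun f : cube => f x) sval).
  exact: cube_proj_continuous.
exact: (@initial_continuous _ R set_val).
Qed.

Lemma cube_continuous (T : topologicalType) (F : T -> cube) :
  (forall x, continuous (fun t => sval (F t x) : R)) -> continuous F.
Proof.
move=> cF t; apply/cvg_sup => x.
apply: (@continuous_comp_initial cube _ _ (fun f : cube => f x)).
by apply: (@continuous_comp_initial (unit_itv R) _ _ set_val); exact: cF.
Qed.

Lemma cube_closed_le (g : cube -> R) (c : R) : continuous g ->
  closed [set f : cube | g f <= c].
Proof.
by move=> cg; apply: (@closed_comp _ _ g [set y | y <= c]) => [x _|];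
  [exact: cg | exact: closed_le].
Qed.

End unit_powers.

(** * Approximate state-morphisms and their limits *)

Section error_terms.
Variables (R : realType) (T : topologicalType).
Implicit Types a b c : T -> R.

Lemma oplus_error_continuous a b c : continuous a -> continuous b ->
  continuous c -> continuous (fun t => `|a t - Num.min (b t + c t) 1|).
Proof.
move=> ca cb cc t; apply: cvg_norm; apply: cvgB; first exact: ca.
apply: (@continuous_min R T (fun t => b t + c t) (fun=> 1)); last exact: cvg_cst.
by apply: cvgD; [exact: cb | exact: cc].
Qed.

Lemma onem_continuous a : continuous a -> continuous (fun t => 1 - a t).
Proof. by move=> ca t; apply: cvgB; [exact: cvg_cst | exact: ca]. Qed.

Lemma opp_error_continuous a b : continuous a -> continuous b ->
  continuous (fun t => `|a t - (1 - b t)|).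
Proof.
move=> ca cb t; apply: cvg_norm; apply: cvgB; first exact: ca.
exact: onem_continuous.
Qed.

End error_terms.

Section states.
Variables (R : realType) (N : mvAlgebra).
Local Notation cube := (prod_topology (fun _ : N => unit_itv R)).
Local Notation zero := (mv_zero N).
Local Notation one := (mv_one N).
Implicit Types (f : cube) (x y : mv_sort N).

(** The homomorphisms of MV-algebras from [N] to the unit interval, up to an
    error [d] in each equation. *)
Definition near_state (d : R) : set cube :=
  [set f : cube | (forall x y,
      `|sval (f (x (+) y)) - Num.min (sval (f x) + sval (f y)) 1| <= d) /\
    forall x, `|sval (f (~' x)) - (1 - sval (f x))| <= d].

Lemma near_state_closed d : closed (near_state d).
Proof.
have ev := @cube_ev_continuous R N.
rewrite (_ : near_state d =
    (\bigcap_(p : mv_sort N * mv_sort N) [set f : cube |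
      `|sval (f (p.1 (+) p.2)) - Num.min (sval (f p.1) + sval (f p.2)) 1| <= d])
    `&` \bigcap_(x : mv_sort N) [set f : cube |
      `|sval (f (~' x)) - (1 - sval (f x))| <= d]); last first.
  apply/seteqP; split=> f [fD fN].
    by split=> [[x y] _|x _] /=; [exact: fD | exact: fN].
  by split=> [x y|x]; [exact: (fD (x, y)) | exact: fN].
apply: closedI; apply: closed_bigI => p _; apply: cube_closed_le.
- by apply: oplus_error_continuous; exact: ev.
- by apply: opp_error_continuous; exact: ev.
Qed.

Lemma near_state0P f : near_state 0 f <->
  (forall x y, f (x (+) y) = (f x : mv_sort (unit_mv R)) (+) f y) /\
  (forall x, f (~' x) = ~' (f x : mv_sort (unit_mv R))).
Proof.
split=> [[fD fN]|[fD fN]].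
  by split=> [x y|x]; apply: val_inj; apply/eqP; rewrite -subr_eq0 -normr_le0;
    [exact: fD | exact: fN].
by split=> [x y|x]; rewrite ?fD ?fN subrr normr0.
Qed.

(** A state-morphism is [1] at [one], and the complement is [lambda] at [one], so
    it is a homomorphism of MV-algebras. Conversely all the other operations are
    terms in [(+)] and the complement. *)
Lemma state_morphismP f : @state_morphism R N f <-> near_state 0 f.
Proof.
rewrite near_state0P; split=> [[fhom [x fx]]|[fD fN]].
  have fx1 : @emv_le (unit_mv R) (f x) (f one).
    exact: etrans (esym (emv_hom_meet fhom x one)) (congr1 f (mv_le1 x)).
  have f1 : f one = mv_one (unit_mv R).
    apply: (@mv_le_anti (unit_mv R)); first exact: mv_le1.
    by move: fx1; rewrite fx.
  split=> [y z|y]; first exact: (emv_hom_oplus fhom).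
  have := emv_hom_lambda fhom (mv_addr1 one) (mv_le1 y) (mv_is_lambda1 y).
  by rewrite f1 (mv_is_lambdaP _ (mv_le1 _)) mv_sub1r.
have fB y z : f (y (-) z) = (f y : mv_sort (unit_mv R)) (-) f z.
  by rewrite /mv_sub !(fD, fN).
have fJ y z : f (mv_join y z) = mv_join (f y : mv_sort (unit_mv R)) (f z).
  by rewrite /mv_join !(fD, fN).
have fM y z : f (mv_meet y z) = mv_meet (f y : mv_sort (unit_mv R)) (f z).
  by rewrite /mv_meet !(fJ, fN).
have f0 : f zero = unit_zero R.
  rewrite -(mv_subrr zero) fB; exact: (mv_subrr (f zero : mv_sort (unit_mv R))).
split; last by exists one; rewrite -mv_oppr0 fN f0; exact: (@mv_oppr0 (unit_mv R)).
split=> // b y z bb yb; rewrite (mv_is_lambdaP _ yb) => ->.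
apply/mv_is_lambdaP; last exact: fB.
exact: etrans (esym (fM y b)) (congr1 f yb).
Qed.

Lemma SM_compact : compact [set: SM R N].
Proof.
apply: compact_subtype; apply: subclosed_compact (@cube_compact R N) _ => //.
rewrite (_ : [set s | _] = near_state 0); first exact: near_state_closed.
by apply/seteqP; split=> f /state_morphismP.
Qed.

(** The approximate homomorphism is [h / H] for the covering numbers of
    [approx_additive]. *)
Lemma near_state_maximal_ideal (A : set N) (k : nat) : maximal_ideal A ->
  exists2 f, near_state k.+1%:R^-1 f & forall x, A x -> sval (f x) = 0.
Proof.
move=> maxA; have [h [H [d [H0 kd [hA hH] hN hD]]]] := approx_additive maxA k.+1.
have RH : 0 < H%:R :> R by rewrite ltr0n.
have hP x : [set x : R | 0 <= x <= 1] ((h x)%:R / H%:R).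
  by rewrite /= divr_ge0 ?ler0n// ler_pdivrMr// mul1r ler_nat hH.
pose f : cube := fun x => SigSub (mem_set (hP x)).
have err : d%:R / H%:R <= k.+1%:R^-1 :> R.
  by rewrite ler_pdivrMr// mulrC ler_pdivlMr// -natrM ler_nat mulnC.
have dist a b : (a <= b + d)%N -> (b <= a + d)%N ->
    `|a%:R / H%:R - b%:R / H%:R| <= k.+1%:R^-1 :> R.
  move=> ab ba; apply: le_trans err; rewrite -mulrBl normrM.
  rewrite [X in _ * X]gtr0_norm ?invr_gt0// ler_pM2r ?invr_gt0//.
  by rewrite ler_norml; move: ab ba; rewrite -!(ler_nat R) !natrD; lra.
have fE x : sval (f x) = (h x)%:R / H%:R by [].
exists f; last by move=> x Ax; rewrite fE hA// mul0r.
split=> [x y|x]; rewrite !fE.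
- have [xyle xyge] := hD x y.
  rewrite (_ : Num.min _ _ = (minn H (h x + h y))%:R / H%:R); last first.
    rewrite -mulrDl -natrD -[X in Num.min _ X](@divff _ H%:R) ?gt_eqF//.
    rewrite -minr_pMl ?invr_ge0 ?ler0n// minC; congr (_ / _).
    by rewrite minEle ler_nat /minn ltn_neqAle; case: eqP => [<-|_] /=; case: ifP.
  by apply: dist => //; rewrite (leq_trans _ (leq_addr _ _))// leq_min hH xyle.
- rewrite (_ : 1 - _ = (H - h x)%:R / H%:R); last first.
    by rewrite natrB// mulrBl divff// gt_eqF.
  have := hN x; have := hH x => ? ?; apply: dist; lia.
Qed.

(** Hoelder's theorem for the simple MV-algebra [N / A], in the form of a
    homomorphism whose kernel contains [A]. The approximate ones cluster in the
    compact cube, and each equation up to [1 / k] is a closed condition. *)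
Lemma state_of_maximal_ideal (A : set N) : maximal_ideal A ->
  exists s : SM R N, forall x, A x -> sval (sval s x) = 0.
Proof.
move=> maxA.
have /choice[u uP] : forall k, exists f : cube,
    near_state k.+1%:R^-1 f /\ forall x, A x -> sval (f x) = 0.
  by move=> k; have [f] := near_state_maximal_ideal k maxA; exists f.
have [s [_ us]] := @cube_compact R N (u @ \oo) _ filterT.
have s_closed (C : set cube) : closed C -> (\forall k \near \oo, C (u k)) -> C s.
  move=> clC Cu; apply: clC => B sB.
  by have [t [Ct Bt]] := us C B Cu sB; exists t.
have ns : near_state 0 s.
  suff ns k : near_state k.+1%:R^-1 s.
    have le0 (a : R) : (forall n, a <= n.+1%:R^-1) -> a <= 0.
      move=> an; rewrite leNgt; apply/negP => /ltr_add_invr[n].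
      by rewrite add0r ltNge an.
    by split=> [x y|x]; apply: le0 => n; case: (ns n).
  apply: s_closed; first exact: near_state_closed.
  exists k => // m /= km; have [[uD uN] _] := uP m.
  have mk : m.+1%:R^-1 <= k.+1%:R^-1 :> R.
    by rewrite lef_pV2 ?posrE ?ltr0n// ler_nat.
  by split=> [x y|x]; apply: le_trans mk.
exists (SigSub (mem_set ((state_morphismP s).2 ns))) => x Ax.
apply/eqP; rewrite eq_le; have /andP[-> _] := unit_itv_bounds (s x); rewrite andbT.
apply: (s_closed [set f : cube | sval (f x) <= 0]).
  by apply: cube_closed_le; exact: cube_ev_continuous.
by apply: nearW => k /=; have [_ ->] := uP k.
Qed.

End states.

(** * The spaces of state-morphisms and of maximal ideals *)

Definition ev (R : realType) (E : emvSig) (s : SM R E) (x : E) : R :=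
  sval (sval s x).

Section state_space.
Variables (R : realType) (E : emvSig).
Implicit Types (s t : SM R E) (x y : E).

Lemma ev_state s : state_morphism (sval s). Proof. exact: set_valP s. Qed.

Lemma ev_bounds s x : 0 <= ev s x <= 1. Proof. exact: unit_itv_bounds. Qed.

Lemma ev_ext s t : ev s =1 ev t -> s = t.
Proof.
move=> st; apply: val_inj; apply: funext => x; apply: val_inj; exact: st.
Qed.

Lemma ev_oplus s x y : ev s (emv_oplus x y) = Num.min (ev s x + ev s y) 1.
Proof. by rewrite /ev (emv_hom_oplus (ev_state s).1). Qed.

Lemma ev_meet s x y : ev s (emv_meet x y) = Num.min (ev s x) (ev s y).
Proof.
by rewrite /ev (emv_hom_meet (ev_state s).1) [LHS]unit_meetE.
Qed.

Lemma ev0 s : ev s emv_zero = 0.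
Proof. by rewrite /ev (emv_hom_zero (ev_state s).1). Qed.

Lemma ev_le s x y : emv_le x y -> ev s x <= ev s y.
Proof. by move=> <-; rewrite ev_meet ge_min lexx orbT. Qed.

Lemma ev_idem s x : emv_idem x -> ev s x = 0 \/ ev s x = 1.
Proof.
have /andP[x0 x1] := ev_bounds s x.
move=> /(congr1 (ev s)); rewrite ev_oplus.
by case: leP => *; [left; lra | right; lra].
Qed.

Lemma ev_continuous x : continuous (fun s : SM R E => ev s x).
Proof.
move=> s; apply: (@continuous_comp _ _ _ (fun s : SM R E => sval s)
  (fun f : prod_topology (fun _ : E => unit_itv R) => sval (f x) : R)).
  exact: (@initial_continuous _ _ set_val).
exact: cube_ev_continuous.
Qed.

Lemma SM_continuous (T : topologicalType) (F : T -> SM R E) :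
  (forall x, continuous (fun z => ev (F z) x)) -> continuous F.
Proof.
move=> cF; apply: (@continuous_comp_initial (SM R E) _ _ set_val).
exact: cube_continuous.
Qed.

Lemma SM_hausdorff : hausdorff_space (SM R E).
Proof.
move=> s t st; apply: ev_ext => x; apply: (@Rhausdorff R) => A B sA tB.
have [u [Au Bu]] := st _ _ (ev_continuous sA) (ev_continuous tB).
by exists (ev u x).
Qed.

End state_space.

Section mv_states.
Variables (R : realType) (N : mvAlgebra).
Implicit Types (s t : SM R N) (x y : mv_sort N) (A I : set N).

Lemma ev_opp s x : ev s (~' x) = 1 - ev s x.
Proof.
have /state_morphismP/near_state0P[_ sN] := ev_state s.
by rewrite /ev sN.
Qed.

Lemma ev1 s : ev s (mv_one N) = 1.
Proof. by rewrite -mv_oppr0 ev_opp ev0 subr0. Qed.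

Lemma ev_muln s n x : (ev s (mv_muln n x) = Num.min (n%:R * ev s x) 1).
Proof.
have /andP[x0 x1] := ev_bounds s x.
elim: n => [|n IHn]; first by rewrite ev0 mul0r min_l.
rewrite mv_mulnS [LHS]ev_oplus IHn -natr1 mulrDl mul1r.
by rewrite !minEle; do !case: ifP => //=; lra.
Qed.

Lemma SM_of_map (f : N -> R) : (forall x, [set y : R | 0 <= y <= 1] (f x)) ->
  (forall x y, f (x (+) y) = Num.min (f x + f y) 1) ->
  (forall x, f (~' x) = 1 - f x) ->
  exists s : SM R N, ev s =1 f.
Proof.
move=> f01 fD fN.
pose g : prod_topology (fun _ : N => unit_itv R) :=
  fun x => SigSub (mem_set (f01 x)).
have gst : @state_morphism R N g.
  apply/state_morphismP; split=> [x y|x] /=.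
    by rewrite /g /= fD subrr normr0.
  by rewrite /g /= fN subrr normr0.
by exists (SigSub (mem_set gst)).
Qed.

Definition state_kernel s : set N := [set x | ev s x = 0].

(** If [ev s x] is positive then a multiple of [x] has value [1], so its complement
    is in the kernel; an ideal containing the kernel and [x] contains [one]. *)
Lemma state_kernel_maximal s : maximal_ideal (state_kernel s).
Proof.
have idK : is_ideal (state_kernel s).
  split; first by exists (mv_zero N); exact: ev0.
  - move=> x y xy y0; apply/eqP; rewrite eq_le.
    by have /andP[-> _] := ev_bounds s x; rewrite andbT -y0; exact: ev_le.
  - by move=> x y x0 y0; rewrite /state_kernel /= ev_oplus x0 y0 addr0 min_l.
split=> [|I pI KI]; first by apply/(mv_properP idK);
  rewrite /state_kernel /= ev1; apply/eqP/oner_neq0.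
apply/seteqP; split=> // x Ix; apply: contrapT => /eqP x0.
have {x0} xgt0 : 0 < ev s x.
  by rewrite lt_neqAle eq_sym x0; have /andP[] := ev_bounds s x.
have [idI _] := pI; move/(mv_properP idI): (pI); apply.
pose n := (Num.truncn (ev s x)^-1).+1.
have nx1 : ev s (mv_muln n x) = 1.
  rewrite ev_muln; apply/min_idPr; rewrite -ler_pdivrMr// mul1r ltW//.
  exact: truncnS_gt.
have Inx : I (mv_muln n x).
  elim: (n) => [|m IHm]; first exact: mv_ideal0.
  by rewrite mv_mulnS; exact: (ideal_oplus idI).
rewrite -(mv_addNr (mv_muln n x)); apply: (ideal_oplus idI) => //.
by apply: KI; rewrite /state_kernel /= ev_opp nx1 subrr.
Qed.

Definition ker_max s : MaxI N := exist _ (state_kernel s) (state_kernel_maximal s).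

Lemma ker_max_surj (A : MaxI N) : exists s, ker_max s = A.
Proof.
case: A => A maxA; have [s sA] := state_of_maximal_ideal R maxA; exists s.
apply: eq_exist; apply: maxA.2; last by move=> x; exact: sA.
exact: (state_kernel_maximal s).1.
Qed.

Lemma ker_max_continuous : continuous ker_max.
Proof.
apply/continuousP => U /open_MaxI_mv[I idI ->].
rewrite (_ : _ @^-1` _ = \bigcup_(x in I) [set s | ev s x != 0]).
  apply: bigcup_open => x _; apply: (@open_comp _ _ (fun s => ev s x) [set y |
    y != 0]).
    by move=> s _; exact: ev_continuous.
  exact: open_neq.
apply/seteqP; split=> [s /= nI|s [x Ix /= sx] IK].
  by apply: contrapT => ns; apply: nI => x Ix; apply: contrapT => /eqP sx;
    apply: ns; exists x.
by move/eqP: sx; apply; exact: IK.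
Qed.

(** As the continuous image of [SM R N] under [ker_max]. *)
Lemma MaxI_compact : compact [set: MaxI N].
Proof.
rewrite (_ : setT = range ker_max); last first.
  by apply/seteqP; split=> // A _; have [s <-] := ker_max_surj A; exists s.
by apply: continuous_compact; [exact/continuous_subspaceT/ker_max_continuous |
  exact: SM_compact].
Qed.

End mv_states.

Lemma MaxI_ext (E : emvSig) (A B : MaxI E) : sval A = sval B -> A = B.
Proof. by case: A B => [A mA] [B mB] /= AB; exact: eq_exist. Qed.

Section MaxI_separation.
Variable N : mvAlgebra.
Implicit Types (x y : mv_sort N) (A : set N).

Definition principal x : set N := [set z | exists n, @emv_le N z (mv_muln n x)].

Lemma principal_ideal x : is_ideal (principal x).
Proof.
split; first by exists (mv_zero N), 0%N; exact: mv_le0.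
- by move=> y z yz [n zn]; exists n; exact: mv_le_trans zn.
- move=> y z [n yn] [m zm]; exists (n + m)%N; rewrite mv_mulnD.
  exact: mv_le_add.
Qed.

Lemma principalP A x : is_ideal A -> principal x `<=` A <-> A x.
Proof.
move=> idA; split=> [|Ax z [n zn]].
  by apply; exists 1%N; rewrite /mv_muln /= mv_addr0; exact: mv_le_refl.
apply: (ideal_down idA zn); elim: n {zn} => [|n IHn]; first exact: mv_ideal0.
by rewrite mv_mulnS; exact: (ideal_oplus idA).
Qed.

Lemma hull_kernel_principal (C : MaxI N) x :
  hull_kernel (principal x) C <-> ~ sval C x.
Proof. by rewrite -(principalP x (svalP C).1.1). Qed.

(** For [x] in [A] only and [y] in [B] only, the differences [x (-) y] and
    [y (-) x] generate ideals whose open sets separate [A] and [B]: they are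
    disjoint since a maximal ideal is prime and the differences meet in [0]. *)
Lemma MaxI_hausdorff : hausdorff_space (MaxI N).
Proof.
rewrite open_hausdorff => -[A maxA] [B maxB] /eqP AB.
have [[idA pA] [idB pB]] := (maxA.1, maxB.1).
have [x [Ax nBx]] : exists x, A x /\ ~ B x.
  apply: contrapT => nx; apply: AB; apply: eq_exist; apply/esym/maxA.2 => //.
  by move=> x Ax; apply: contrapT => nBx; apply: nx; exists x.
have [y [By nAy]] : exists y, B y /\ ~ A y.
  apply: contrapT => ny; apply: AB; apply: eq_exist; apply/maxB.2 => //.
  by move=> y By; apply: contrapT => nAy; apply: ny; exists y.
have nBxy : ~ B (x (-) y).
  move=> Bxy; apply: nBx; apply: (ideal_down idB (mv_le_sub_add x y)).
  exact: (ideal_oplus idB).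
have nAyx : ~ A (y (-) x).
  move=> Ayx; apply: nAy; apply: (ideal_down idA (mv_le_sub_add y x)).
  exact: (ideal_oplus idA).
exists (hull_kernel (principal (y (-) x)), hull_kernel (principal (x (-) y))) => /=.
  by split; apply/mem_set/hull_kernel_principal.
split; [| |apply/eqP/seteqP; split=> // -[C maxC] /=].
- by apply/open_MaxI_mv; eexists; last by []; exact: principal_ideal.
- by apply/open_MaxI_mv; eexists; last by []; exact: principal_ideal.
move=> [/hull_kernel_principal /= nCyx /hull_kernel_principal /= nCxy].
have [|//|//] :=
  @maximal_ideal_prime N (mv_subdistributive N) C (x (-) y) (y (-) x) maxC.
by rewrite /= mv_prelinear; exact: mv_ideal0 maxC.1.1.
Qed.

End MaxI_separation.

(** * The point at infinity *)

Section subalgebra_maximal_ideal.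
Variables (R : realType) (N : mvAlgebra) (M : set N).
Hypotheses (subM : is_emv_subalgebra M) (maxM : maximal_ideal M).
Hypothesis coverN : forall x : N, M x \/ M (mv_neg x).
Implicit Types (x y z a b : mv_sort N) (s t : SM R N).
Local Notation EM := (sub_emv subM).
Local Notation one := (mv_one N).

Let idM : is_ideal M := maxM.1.1.

Lemma state_eq_on_ideal s t : (forall x, M x -> ev s x = ev t x) -> s = t.
Proof.
move=> st; apply: ev_ext => x; have [|/st] := coverN x; first exact: st.
by rewrite !ev_opp; lra.
Qed.

Lemma state_kernel_unique s t : ker_max s = exist _ M maxM ->
  (forall x, M x -> ev t x = 0) -> t = s.
Proof.
move=> /(congr1 sval) /= sM t0; apply: state_eq_on_ideal => x Mx; rewrite t0//.
by have : state_kernel s x by rewrite sM.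
Qed.

Hypothesis emvM : is_emv_algebra EM.
Hypothesis notopM : ~ has_top EM.

Lemma sub_leP (x y : EM) : emv_le x y <-> @emv_le N (sval x) (sval y).
Proof. by split=> [/(congr1 sval)|xy]//; exact: val_inj. Qed.

Lemma sub_bounded x : M x ->
  exists a, [/\ M a, emv_idem (a : N) & @emv_le N x a].
Proof.
move=> Mx; have [a [aa xa]] := emv_bounded emvM (SigSub (mem_set Mx) : EM).
exists (sval a); split; first exact: (set_valP a).
- by have := congr1 sval aa.
- by move/sub_leP: xa.
Qed.

(** Let [b] be an idempotent of [M] not below [a]. Then [d = ~' b (+) a] is an
    idempotent different from [one], so the elements below [d] form a proper ideal.
    A state-morphism vanishing on it is [0] at [a] and [1] at [b]. *)
Lemma state_vanishing_at a : M a -> emv_idem (a : N) ->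
  exists2 t : SM R N, ev t a = 0 & exists2 b, M b & ev t b = 1.
Proof.
move=> Ma aa.
have [x Mx nxa] : exists2 x, M x & ~ @emv_le N x a.
  apply: contrapT => nx; apply: notopM; exists (SigSub (mem_set Ma)) => x.
  apply/sub_leP; apply: contrapT => nxa; apply: nx; exists (sval x) => //.
  exact: (set_valP x).
have [b [Mb bb xb]] := sub_bounded Mx.
pose d := ~' b (+) a.
have dd : emv_idem (d : N) by apply: mv_idemD => //; exact: mv_idemN.
pose I : set N := [set z | @emv_le N z d].
have idI : is_ideal I.
  split; first by exists d; exact: mv_le_refl.
  - by move=> y z; exact: mv_le_trans.
  - by move=> y z yd zd; rewrite /I /= -[X in emv_le _ X]dd; exact: mv_le_add.
have pI : proper_ideal I.
  apply/(mv_properP idI) => d1; apply: nxa; apply: mv_le_trans xb _.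
  apply/mv_leE; rewrite /mv_sub -mv_oppr1; congr mv_neg.
  by apply: mv_le_anti; [exact: mv_le1 | exact: d1].
have [A maxA IA] := mv_proper_sub_maximal pI.
have [t tA] := state_of_maximal_ideal R maxA; exists t.
  by apply: tA; apply: IA; exact: mv_le_addl.
exists b => //; rewrite -[b]mv_opprK ev_opp [X in _ - X]tA ?subr0//.
by apply: IA; exact: mv_le_addr.
Qed.

(** The sets [Z a], for [a] an idempotent of [M], generate a proper filter on the
    compact space [SM R N]. A cluster point vanishes at all idempotents of [M],
    hence on [M], so it is [s]; but the [Z a] avoid [s]. *)
Lemma state_at_infinity_not_open s : ker_max s = exist _ M maxM ->
  ~ open [set s].
Proof.
move=> sM os.
have s0 x : M x -> ev s x = 0.
  by move: sM => /(congr1 sval) /= sM Mx; have : state_kernel s x by rewrite sM.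
pose Z a : set (SM R N) := [set t : SM R N | ev t a = 0 /\ t <> s].
pose D : set N := [set a | M a /\ emv_idem a].
have ZF : ProperFilter (filter_from D Z).
  apply: filter_from_proper; last first.
    move=> a [Ma aa]; have [t ta [b Mb tb]] := state_vanishing_at Ma aa.
    exists t; split=> // ts; have := s0 b Mb; rewrite -ts tb; exact/eqP/oner_neq0.
  apply: filter_from_filter.
    exists (mv_zero N); split; first exact: mv_ideal0.
    exact: mv_addr0.
  move=> a b [Ma aa] [Mb bb]; exists (a (+) b).
    by split; [exact: (ideal_oplus idM) | exact: mv_idemD].
  move=> t [tab ts].
  have := ev_le t (mv_le_addr a b); have := ev_le t (mv_le_addl b a).
  have /andP[a0 _] := ev_bounds t a; have /andP[b0 _] := ev_bounds t b.
  by rewrite tab => ? ?; split; split=> //; lra.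
have [t [_ tZ]] := @SM_compact R N _ ZF filterT.
have t0 a : D a -> ev (t : SM R N) a = 0.
  move=> Da; suff : closed [set u : SM R N | ev u a = 0].
    apply; move=> B tB; have [|u [[ua _] Bu]] := tZ (Z a) B _ tB; last by exists u.
    by exists a.
  apply: (@closed_comp _ _ (fun u : SM R N => ev u a) [set y : R | y = 0]).
    by move=> u _; exact: ev_continuous.
  exact: closed_eq.
have ts : t = s.
  apply: state_kernel_unique sM _ => x Mx; have [a [Ma aa xa]] := sub_bounded Mx.
  have := ev_le t xa; have /andP[x0 _] := ev_bounds t x.
  by rewrite (t0 a (conj Ma aa)) => ?; lra.
rewrite ts in tZ.
have [||u [[_ us]] //] := tZ (Z (mv_zero N)) [set s].
- exists (mv_zero N) => //; split; first exact: mv_ideal0.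
  exact: mv_addr0.
- exact: open_nbhs_nbhs.
Qed.

Lemma maximal_at_infinity_not_open : ~ open [set exist _ M maxM : MaxI N].
Proof.
move=> oM; have [s sM] := ker_max_surj R (exist _ M maxM : MaxI N).
apply: (state_at_infinity_not_open sM).
have /continuousP/(_ _ oM) := @ker_max_continuous R N.
congr open; apply/seteqP; split=> [t tM|_ -> //].
apply: (state_kernel_unique sM) => x Mx; move: tM => /(congr1 sval) /= tM.
by have : state_kernel t x by rewrite tM.
Qed.

End subalgebra_maximal_ideal.

(** * The embeddings of the spaces of the subalgebra *)

Section idempotent_cut.
Variable N : mvAlgebra.
Implicit Types a x y : mv_sort N.

(** This and [mv_meet_idemN] say that meeting with an idempotent [a] is a
    homomorphism of [N] onto the MV-algebra [[0,a]]. *)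
Lemma mv_meet_idemD a x y : emv_idem (a : N) ->
  mv_meet (x (+) y) a = mv_meet x a (+) mv_meet y a.
Proof.
move=> aa; apply: mv_le_anti.
  by rewrite !(mv_meetC _ a); exact: mv_meet_add.
apply: mv_le_meet; first by apply: mv_le_add; exact: mv_le_meetl.
by rewrite -[X in emv_le _ X]aa; apply: mv_le_add; exact: mv_le_meetr.
Qed.

(** [x (+) b] is below [x (-) b (+) b (+) b], and that is the join
    [x (-) b (+) b] because [b] is idempotent. *)
Lemma mv_join_idem b x : emv_idem (b : N) -> mv_join x b = x (+) b.
Proof.
move=> bb; apply: mv_le_anti.
  by apply: mv_join_lub; [exact: mv_le_addr | exact: mv_le_addl].
apply: (@mv_le_trans _ (x (-) b (+) b (+) b)).
  by apply: mv_le_add2r; exact: mv_le_sub_add.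
by rewrite -mv_addrA [b (+) b]bb; exact: mv_le_refl.
Qed.

Lemma mv_meet_idemN a x : emv_idem (a : N) ->
  mv_meet (~' x) a = a (-) mv_meet x a.
Proof.
move=> aa.
have idem_sub v : mv_meet (~' v) a = a (-) v.
  rewrite /mv_meet mv_opprK (mv_join_idem v (mv_idemN aa)).
  by rewrite /mv_sub (mv_addrC v).
apply: mv_le_anti.
  rewrite -idem_sub; apply: mv_le_meet; last exact: mv_le_meetr.
  apply: mv_le_trans (mv_le_meetl _ _) _; apply: mv_le_opp; exact: mv_le_meetl.
apply/mv_le_subl; rewrite !(mv_meetC _ a).
rewrite -[X in emv_le X _](mv_meet_idl (mv_le1 a)) -(mv_addNr x).
exact: mv_meet_add.
Qed.

End idempotent_cut.

Section embeddings.
Variables (R : realType) (N : mvAlgebra) (M : set N).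
Hypotheses (subM : is_emv_subalgebra M) (maxM : maximal_ideal M).
Hypothesis coverN : forall x : N, M x \/ M (mv_neg x).
Implicit Types (x y z a b : mv_sort N) (t : SM R N) (A I : set N).
Local Notation EM := (sub_emv subM).
Local Notation one := (mv_one N).
Implicit Types (m : EM) (B J : set EM).
Hypothesis emvM : is_emv_algebra EM.
Hypothesis notopM : ~ has_top EM.

Let idM : is_ideal M := maxM.1.1.
Let leP := @sub_leP N M subM.

Lemma M_sval m : M (sval m). Proof. exact: set_valP m. Qed.

Lemma sub_subdistributive : subdistributive EM.
Proof.
split.
- by move=> m; apply/leP; exact: mv_le_refl.
- by move=> m m1 m2 /leP h /leP h'; apply/leP; exact: mv_le_trans h'.
- by move=> m; apply/leP; exact: mv_le0.
- by move=> m m1; apply/leP; exact: mv_le_meetl.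
- by move=> m m1; apply/leP; exact: mv_le_meetr.
- by move=> m m1 m2 /leP h /leP h'; apply/leP; exact: mv_le_meet.
- by move=> m m1 m2; apply/leP; exact: mv_meet_add.
Qed.

Let meetM_subproof x m : M (mv_meet x (sval m)).
Proof. by apply: (ideal_down idM) (M_sval m); exact: mv_le_meetr. Qed.

(** It is an element of [M] because [M], being an ideal of [N], is downward
    closed. *)
Definition meetM x m : EM := SigSub (mem_set (meetM_subproof x m)).

Definition extend_ideal B : set N := [set x | forall m, B (meetM x m)].
Definition restrict_ideal A : set EM := [set m | A (sval m)].

Lemma extend_ideal_ideal B : is_ideal B -> is_ideal (extend_ideal B).
Proof.
move=> idB; have [m0 Bm0] := ideal_neq0 idB; split.
- exists (mv_zero N) => m; apply: (ideal_down idB) Bm0; apply/leP.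
  by apply: mv_le_trans (mv_le_meetl _ _) (mv_le0 _).
- move=> x y xy yB m; apply: (ideal_down idB) (yB m); apply/leP.
  apply: mv_le_meet; last exact: mv_le_meetr.
  by apply: mv_le_trans xy; exact: mv_le_meetl.
- move=> x y xB yB m; apply: (ideal_down idB) (ideal_oplus idB (xB m) (yB m)).
  by apply/leP => /=; rewrite !(mv_meetC _ (sval m)); exact: mv_meet_add.
Qed.

Lemma restrict_ideal_ideal A : is_ideal A -> is_ideal (restrict_ideal A).
Proof.
move=> idA; split.
- by exists emv_zero; exact: mv_ideal0.
- by move=> m m' /leP mm'; exact: (ideal_down idA).
- by move=> m m'; exact: (ideal_oplus idA).
Qed.

(** Extension is right adjoint to restriction, which yields the continuity of the
    embedding and most of the correspondence of ideals. *)
Lemma extend_restrict_adj I B : is_ideal I ->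
  I `<=` extend_ideal B <-> restrict_ideal I `<=` B.
Proof.
move=> idI; split=> [IB m Im|IB x Ix m].
  rewrite (_ : m = meetM (sval m) m); first exact: IB.
  by apply: val_inj; rewrite /= (mv_meet_idl (mv_le_refl _)).
by apply: IB; apply: (ideal_down idI) Ix; exact: mv_le_meetl.
Qed.

Lemma restrict_extend B : is_ideal B -> restrict_ideal (extend_ideal B) = B.
Proof.
move=> idB; apply/seteqP; split.
  by apply/extend_restrict_adj; first exact: extend_ideal_ideal.
move=> m Bm m'; apply: (ideal_down idB) Bm; apply/leP; exact: mv_le_meetl.
Qed.

Lemma restrict_idealT I : is_ideal I -> proper_ideal I ->
  restrict_ideal I = setT -> I = M.
Proof.
move=> idI pI IT; apply: maxM.2 => // x Mx.
have : setT (SigSub (mem_set Mx) : EM) by [].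
by rewrite -IT.
Qed.

(** For an idempotent [a] of [M] outside [B], primeness of [B] puts every
    [~' a /\ m] in [B]; so the extension contains [~' a], which is not in [M]. *)
Lemma extend_ideal_notsub B : maximal_ideal B -> ~ (extend_ideal B `<=` M).
Proof.
move=> maxB; have [[idB /eqP pB] _] := maxB => BM; apply: pB.
apply/seteqP; split=> // m _; apply: contrapT => nBm.
have [a [Ma aa ma]] := sub_bounded emvM (M_sval m).
pose a' : EM := SigSub (mem_set Ma).
suff /BM MNa : extend_ideal B (~' a).
  have [_ /(mv_properP idM)] := (idM, maxM.1); apply.
  by rewrite -(mv_addNr a); exact: (ideal_oplus idM).
move=> m'; have [||//] :=
  @maximal_ideal_prime EM sub_subdistributive B a' (meetM (~' a) m') maxB.
  rewrite (_ : emv_meet _ _ = emv_zero).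
    by have [m0 Bm0] := ideal_neq0 idB; apply: (ideal_down idB) Bm0; apply/leP;
      exact: mv_le0.
  apply: val_inj; apply: mv_le0E => /=; rewrite -(mv_idem_meetN aa).
  apply: mv_le_meet; first exact: mv_le_meetl.
  by apply: mv_le_trans (mv_le_meetr _ _) _; exact: mv_le_meetl.
by move=> Ba'; case: nBm; apply: (ideal_down idB) Ba'; apply/leP.
Qed.

(** A proper ideal [I] above the extension restricts to [B] or to all of [M]. In
    the second case [I] is [M] by maximality of [M], against
    [extend_ideal_notsub]. *)
Lemma extend_ideal_maximal B : maximal_ideal B -> maximal_ideal (extend_ideal B).
Proof.
move=> maxB; have [[idB pB] maxB'] := maxB.
have idX := extend_ideal_ideal idB.
have nX := extend_ideal_notsub maxB.
split=> [|I pI XI].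
  split=> //; apply/eqP => XT; move/eqP: pB; apply.
  by rewrite -(restrict_extend idB) XT.
have [idI _] := pI; have idRI := restrict_ideal_ideal idI.
apply/seteqP; split=> //; apply/(extend_restrict_adj _ idI).
have [RT|/eqP pR] := pselect (restrict_ideal I = setT).
  by case: nX; rewrite -(restrict_idealT idI pI RT).
rewrite (maxB' _ (conj idRI pR))// -{1}(restrict_extend idB) => m; exact: XI.
Qed.

(** Any proper ideal above the restriction of [A] extends to a proper ideal above
    [A], hence to [A] itself, and it is recovered by restriction. *)
Lemma restrict_ideal_maximal A : maximal_ideal A -> A <> M ->
  maximal_ideal (restrict_ideal A) /\ extend_ideal (restrict_ideal A) = A.
Proof.
move=> maxA AM; have [[idA pA] maxA'] := maxA.
have idR := restrict_ideal_ideal idA.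
have extA J : proper_ideal J -> restrict_ideal A `<=` J -> extend_ideal J = A.
  move=> [idJ pJ] RJ; apply: maxA'; last exact/extend_restrict_adj.
  split; first exact: extend_ideal_ideal.
  apply/eqP => JT; move/eqP: pJ; apply.
  by rewrite -(restrict_extend idJ) JT.
have pR : proper_ideal (restrict_ideal A).
  by split=> //; apply/eqP => RT; apply: AM; exact: restrict_idealT RT.
split; last exact: extA.
split=> // J pJ RJ.
by rewrite -(extA J pJ RJ) restrict_extend//; case: pJ.
Qed.

Definition extend_max (B : MaxI EM) : MaxI N :=
  exist _ _ (extend_ideal_maximal (svalP B)).

Lemma MaxI_sub_one_point_compactification :
  is_one_point_compactification (MaxI EM) (MaxI N).
Proof.
have idS (B : MaxI EM) : is_ideal (sval B) := (svalP B).1.1.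
apply: (@open_embedding_one_point_compactification _ _ extend_max
  (exist _ M maxM : MaxI N)).
- exact: MaxI_hausdorff.
- exact: (MaxI_compact R).
- apply/continuousP => U /open_MaxI_mv[I idI ->].
  apply/open_MaxI_sub; exists (restrict_ideal I); first exact: restrict_ideal_ideal.
  by apply/seteqP; split=> B nI IB; apply: nI; apply/(extend_restrict_adj _ idI).
- move=> B B' /(congr1 sval) /= BB'; apply: MaxI_ext.
  by rewrite -(restrict_extend (idS B)) BB' restrict_extend.
- move=> U /open_MaxI_sub[J idJ ->]; apply/open_MaxI_mv.
  exists [set x | exists2 m : EM, J m & sval m = x].
    split; first by have [m Jm] := ideal_neq0 idJ; exists (sval m), m.
    - move=> x y xy [m Jm my].
      exists (meetM x m); last by rewrite /= my.
      by apply: (ideal_down idJ) Jm; apply/leP; exact: mv_le_meetr.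
    - move=> x y [m Jm <-] [m' Jm' <-]; exists (emv_oplus m m') => //.
      exact: (ideal_oplus idJ).
  apply/seteqP; split=> [_ [B /= nJ <-] JB|A /= nJ].
    apply: nJ => m Jm; rewrite -(restrict_extend (idS B)); apply: JB.
    by exists m.
  have AM : sval A <> M.
    by move=> AM; apply: nJ => _ [m _ <-]; rewrite AM; exact: M_sval.
  have [maxR extR] := restrict_ideal_maximal (svalP A) AM.
  exists (exist _ _ maxR); last exact: MaxI_ext.
  by move=> /= JR; apply: nJ => _ [m Jm <-]; exact: JR.
- apply/seteqP; split=> [_ [B _ <-] /(congr1 sval) /= BM|A AM].
    by case: (extend_ideal_notsub (svalP B)); rewrite BM.
  have AM' : sval A <> M by move=> AM'; apply: AM; exact: MaxI_ext.
  have [maxR extR] := restrict_ideal_maximal (svalP A) AM'.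
  by exists (exist _ _ maxR) => //; exact: MaxI_ext.
- exact: (maximal_at_infinity_not_open R).
Qed.

Lemma sub_is_lambdaP (b m m' : EM) : emv_le m b ->
  is_lambda b m m' <-> sval m' = sval b (-) sval m.
Proof.
move=> /leP mb.
have Mbm : M (sval b (-) sval m).
  by apply: (ideal_down idM) (M_sval b); exact: mv_le_subr_id.
have [lam1 lam2 lam3] := (mv_is_lambdaP _ mb).2 erefl.
have lam : is_lambda b m (SigSub (mem_set Mbm)).
  split; [exact/leP | exact: val_inj | move=> w /leP wb /(congr1 sval) wm].
  by apply/leP; exact: lam3.
split=> [[l1 l2 l3]|e].
  have [k1 k2 k3] := lam.
  by apply: mv_le_anti; [have /leP := l3 _ k1 k2 | have /leP := k3 _ l1 l2].
by rewrite (_ : m' = SigSub (mem_set Mbm))//; exact: val_inj.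
Qed.

(** The extension is [x |-> s (x /\ a)] for an idempotent [a] with [s a = 1]. *)
Lemma state_extend (s : SM R EM) :
  exists t : SM R N, forall m, ev t (sval m) = ev s m.
Proof.
have [x sx] := (ev_state s).2.
have [a [aa xa]] := emv_bounded emvM x.
have aaN : emv_idem (sval a : N) := congr1 sval aa.
have sa : ev s a = 1.
  apply/eqP; rewrite eq_le; have /andP[_ ->] := ev_bounds s a.
  by apply: le_trans (ev_le s xa); rewrite /ev sx.
have [x'|x' y|x'|t ts] := @SM_of_map R N (fun x => ev s (meetM x a)).
- exact: ev_bounds.
- by rewrite -ev_oplus; congr (ev s _); apply: val_inj; exact: mv_meet_idemD.
- have la : emv_le (meetM x' a) a by apply/leP; exact: mv_le_meetr.
  have /(emv_hom_lambda (ev_state s).1 aa la) :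
      is_lambda a (meetM x' a) (meetM (~' x') a).
    by apply/sub_is_lambdaP => //; exact: mv_meet_idemN.
  have sla := emv_hom_meet (ev_state s).1 (meetM x' a) a.
  rewrite la in sla.
  rewrite (mv_is_lambdaP _ (esym sla)) => /(congr1 sval).
  rewrite unit_subE -/(ev s _) -/(ev s _) -/(ev s _) sa.
  rewrite max_l// subr_ge0; by case/andP: (ev_bounds s (meetM x' a)).
exists t => m; rewrite ts (_ : meetM _ _ = emv_meet m a); last exact: val_inj.
by rewrite ev_meet sa min_l//; case/andP: (ev_bounds s m).
Qed.

(** The value [1] is taken at an idempotent above [m], as a state-morphism is [0]
    or [1] at idempotents. *)
Lemma state_restrict t m : ev t (sval m) <> 0 ->
  exists s : SM R EM, forall m', ev s m' = ev t (sval m').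
Proof.
move=> tm; have thom := (ev_state t).1.
pose f : prod_topology (fun _ : EM => unit_itv R) := fun m' => sval t (sval m').
have fst : @state_morphism R EM f.
  split.
    split=> [m1 m2|m1 m2|m1 m2||b m1 m2 bb mb lam].
    - exact: (emv_hom_join thom).
    - exact: (emv_hom_meet thom).
    - exact: (emv_hom_oplus thom).
    - exact: (emv_hom_zero thom).
    - apply: (emv_hom_lambda thom); first exact: (congr1 sval bb).
        exact/leP.
      apply/mv_is_lambdaP; first exact/leP.
      exact/(sub_is_lambdaP _ mb).
  have [a [Ma aa ma]] := sub_bounded emvM (M_sval m).
  exists (SigSub (mem_set Ma)); apply: val_inj => /=.
  have [ta|//] := ev_idem t aa; case: tm; apply/eqP; rewrite eq_le.
  by have /andP[-> _] := ev_bounds t (sval m); rewrite -ta ev_le.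
by exists (SigSub (mem_set fst)).
Qed.

Lemma SM_sub_one_point_compactification :
  is_one_point_compactification (SM R EM) (SM R N).
Proof.
have [s0 s0M] := ker_max_surj R (exist _ M maxM : MaxI N).
have s0_eq t : (forall x, M x -> ev t x = 0) -> t = s0.
  exact: (state_kernel_unique coverN s0M).
have s0_0 m : ev s0 (sval m) = 0.
  have : sval (ker_max s0) (sval m) by rewrite s0M; exact: M_sval.
  by [].
have /choice[r rP] := state_extend.
have r_neq s : r s <> s0.
  move=> rs; have [m sm] := (ev_state s).2.
  have := rP s m; rewrite rs s0_0 /ev sm /= => /esym/eqP.
  by rewrite oner_eq0.
have r_surj t : t <> s0 -> exists s, r s = t.
  move=> ts0.
  have [m tm] : exists m : EM, ev t (sval m) <> 0.
    apply: contrapT => nt; apply: ts0; apply: s0_eq => x Mx.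
    by apply: contrapT => tx; apply: nt; exists (SigSub (mem_set Mx)).
  have [s sP] := state_restrict tm; exists s.
  apply: (state_eq_on_ideal coverN) => x Mx.
  by rewrite (rP s (SigSub (mem_set Mx))) sP.
apply: (@open_embedding_one_point_compactification _ _ r s0).
- exact: SM_hausdorff.
- exact: SM_compact.
- apply: SM_continuous => x; have [Mx|Mx] := coverN x.
    rewrite (_ : (fun s => _) = fun s => ev s (SigSub (mem_set Mx) : EM)).
      exact: ev_continuous.
    by apply: funext => s; rewrite -rP.
  rewrite (_ : (fun s => _) = fun s => 1 - ev s (SigSub (mem_set Mx) : EM)).
    by apply: onem_continuous; exact: ev_continuous.
  by apply: funext => s; rewrite -rP ev_opp subKr.
- by move=> s s' rs; apply: ev_ext => m; rewrite -!rP rs.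
- move=> U [W oW <-].
  pose q (t : SM R N) : prod_topology (fun _ : EM => unit_itv R) :=
    fun m => sval t (sval m).
  have qr s : q (r s) = sval s.
    by apply: funext => m; apply: val_inj; exact: rP.
  have cq : continuous q.
    by apply: cube_continuous => m; exact: ev_continuous.
  rewrite (_ : _ @` _ = q @^-1` W `&` ~` [set s0]).
    apply: openI; first by move/continuousP: cq; exact.
    apply: closed_openC; apply: accessible_closed_set1.
    exact/hausdorff_accessible/SM_hausdorff.
  apply/seteqP; split=> [_ [s Ws <-]|t [Wt ts0]].
    by split; [rewrite /= qr | exact: r_neq].
  have [s st] := r_surj t ts0; exists s => //.
  by move: Wt; rewrite /= -st qr.
- apply/seteqP; split=> [_ [s _ <-]|t ts0]; first exact: r_neq.
  by have [s <-] := r_surj t ts0; exists s.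
- exact: (state_at_infinity_not_open coverN emvM notopM s0M).
Qed.

End embeddings.

Theorem theorem4p13 (R : realType) (N : mvAlgebra) (M : set N)
    (subM : is_emv_subalgebra M)
    (emvM : is_emv_algebra (sub_emv subM))
    (notopM : ~ has_top (sub_emv subM))
    (maxM : maximal_ideal M)
    (coverN : forall x : N, M x \/ M (mv_neg x)) :
  is_one_point_compactification (SM R (sub_emv subM)) (SM R N) /\
  is_one_point_compactification (MaxI (sub_emv subM)) (MaxI N).
Proof.
split; first exact: SM_sub_one_point_compactification.
exact: (MaxI_sub_one_point_compactification R).
Qed.
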